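(* Consider probabilistic direct search (PDS, as described in the context) with $f:\mathbb{R}^n\to\mathbb{R}$ differentiable, convex, and bounded below on $\mathbb{R}^n$, and with $\nabla f$ Lipschitz continuous on $\mathbb{R}^n$. Let each $\mathfrak{D}_k$ be a set of $m$ i.i.d. random vectors uniformly distributed on the unit sphere in $\mathbb{R}^n$, with no dependence on existing polling directions or iterates (i.e. independent of $\mathcal{F}_{k-1}$). Suppose that $x_0\notin\mathcal{S}(f)$, $\gamma>1$, and $\log_2(1-\log\theta/\log\gamma)$ is not an integer. Let $p_0=\dfrac{\log\theta}{\log(\gamma^{-1}\theta)}$ and $G_k=\nabla f(X_k)$. Then the following statements are equivalent. (a) $\mathbb{P}(\liminf_{k\to\infty}\|G_k\|=0)=1$. (b) $m>\log_2(1-\log\theta/\log\gamma)$. (c) $\{\mathfrak{D}_k\}$ is a sequence of $p_0$-probabilistic $\kappa$-descent sets for some $\kappa>0$.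
   Context: PDS. Fix $n\ge 1$, an objective $f:\mathbb{R}^n\to\mathbb{R}$, a deterministic starting point $x_0\in\mathbb{R}^n$, a deterministic initial step size $\alpha_0>0$, constants $\theta\in(0,1)$ and $\gamma\in[1,\infty)$, and a forcing function $\rho:(0,\infty)\to(0,\infty)$, which is nondecreasing with $\rho(\alpha)=o(\alpha)$ as $\alpha\to 0^+$. On a probability space $(\Omega,\mathcal{F},\mathbb{P})$, PDS generates random polling direction sets $\mathfrak{D}_k$, random iterates $X_k$ and random step sizes $A_k$, $k\ge 0$, with $X_0=x_0$, $A_0=\alpha_0$, as follows. For each $k\ge 0$, $\mathfrak{D}_k$ is nonempty and consists of finitely many random vectors in $\mathbb{R}^n$ of Euclidean norm $1$. If some $d\in\mathfrak{D}_k$ satisfies $f(X_k)-f(X_k+A_kd)>\rho(A_k)$, then $X_{k+1}=X_k+A_kd_k$ for some $d_k\in\mathfrak{D}_k$ satisfying this inequality (the selection rule is unspecified and may involve additional randomness) and $A_{k+1}=\gamma A_k$; otherwise $X_{k+1}=X_k$ and $A_{k+1}=\theta A_k$. Filtration: $\mathcal{F}_{-1}=\{\emptyset,\Omega\}$ and $\mathcal{F}_k=\sigma(\mathfrak{D}_0,X_1,\dots,\mathfrak{D}_k,X_{k+1})$ for $k\ge 0$. Equalities and inequalities involving conditional probabilities given a $\sigma$-algebra are understood almost surely. Cosine measure: for a finite nonempty set $\mathcal{D}$ of nonzero vectors in $\mathbb{R}^n$ and $v\ne 0$, $\operatorname{cm}(\mathcal{D},v)=\max_{d\in\mathcal{D}}\frac{d^{\mathsf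 T}v}{\|d\|\|v\|}$; for $v=0$, $\operatorname{cm}(\cdot,0)$ is by convention a constant in $[-1,1]$, whose value is not specified. Probabilistic descent: for $p\in[0,1]$ and $\kappa\in[-1,1]$, $\{\mathfrak{D}_k\}$ is a sequence of $p$-probabilistic $\kappa$-descent sets if $\mathbb{P}(\operatorname{cm}(\mathfrak{D}_k,-G_k)\ge\kappa\mid\mathcal{F}_{k-1})\ge p$ for each $k\ge 0$. Notation: $\|\cdot\|$ is the Euclidean norm, $\inf f=\inf_{x\in\mathbb{R}^n}f(x)$ and $\mathcal{S}(f)=\{x\in\mathbb{R}^n:f(x)=\inf f\}$ (possibly empty).
   Formalization: (b)⇒(c) is stated only when the conventional value cm(·,0) is positive or G_k≠0 a.s. for every k; otherwise it can fail (e.g. f=x²/2, where an iterate hits the minimizer with positive probability). (a)⇔(b) and (c)⇒(b) are unconditional. *)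

(* Defs.v *)
From HB Require Import structures.
From mathcomp Require Import all_boot all_order all_algebra.
From mathcomp Require Import all_classical all_reals all_analysis.

Set Implicit Arguments.
Unset Strict Implicit.
Unset Printing Implicit Defensive.

Import Order.TTheory GRing.Theory Num.Theory.
Import numFieldNormedType.Exports.

Local Open Scope classical_set_scope.
Local Open Scope ring_scope.

Section Euclid.
Context {R : realType} {n : nat}.
Implicit Types u v x y : 'rV[R]_n.

Definition dot u v : R := \sum_(i < n) u 0 i * v 0 i.

(* The library norm on 'rV[R]_n is the sup norm; it induces the Euclidean
   topology, and hence the same notion of differentiability, but it is not the
   norm to be used in quantitative statements. *)
Definition enorm u : R := Num.sqrt (dot u u).

Definition gradient (f : 'rV[R]_n -> R) x : 'rV[R]_n :=
  \row_(i < n) 'D_(delta_mx 0 i) f x.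

Definition elipschitz (g : 'rV[R]_n -> 'rV[R]_n) : Prop :=
  exists L : R, forall x y, enorm (g x - g y) <= L * enorm (x - y).

Definition minimizers (f : 'rV[R]_n -> R) : set 'rV[R]_n :=
  [set x | f x = inf (range f)].

Definition borel : set (set 'rV[R]_n) := <<s [set A | open A] >>.

Definition sphere : set 'rV[R]_n := [set x | enorm x = 1].

(* For m > 0 the initial value -1 does not affect the maximum, since every
   cosine is at least -1. cm0 is the conventional value of cm(D, 0). *)
Definition cm (cm0 : R) (m : nat) (D : 'I_m -> 'rV[R]_n) v : R :=
  if v == 0 then cm0
  else \big[Num.max/-1]_(i < m) (dot (D i) v / (enorm (D i) * enorm v)).

End Euclid.

Definition log2 {R : realType} (x : R) : R := ln x / ln 2.

Section Probability.
Context {d : measure_display} {T : measurableType d} {R : realType}.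
Variable P : probability T R.

Definition random_vector {n : nat} (X : T -> 'rV[R]_n) : Prop :=
  forall B, borel B -> measurable (X @^-1` B).

(* The law of X is the uniform distribution on the unit sphere: the rotation
   invariant Borel probability measure on it (for n = 1, the uniform law on
   {-1, 1}). *)
Definition uniform_on_sphere {n : nat} (X : T -> 'rV[R]_n) : Prop :=
  P (X @^-1` sphere) = 1%E /\
  forall Q : 'M[R]_n, Q *m Q^T = 1%:M ->
  forall B, borel B ->
    P ((fun w => X w *m Q) @^-1` B) = P (X @^-1` B).

Definition mutually_independent {n m : nat} (X : 'I_m -> T -> 'rV[R]_n) :
    Prop :=
  forall (J : {set 'I_m}) (B : 'I_m -> set 'rV[R]_n),
    (forall i, borel (B i)) ->
    P (\bigcap_(i in [set` J]) (X i @^-1` B i)) =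
    (\prod_(i in J) P (X i @^-1` B i))%E.

Definition independent_sigma (F G : set (set T)) : Prop :=
  forall E H, F E -> G H -> P (E `&` H) = (P E * P H)%E.

Definition cond_prob_version (F : set (set T)) (E : set T) (g : T -> R) :
    Prop :=
  [/\ forall Y : set R, measurable Y -> F (g @^-1` Y),
      P.-integrable setT (EFin \o g) &
      forall B, F B -> (\int[P]_(w in B) (g w)%:E = P (E `&` B))%E].

(* P(E | F) >= p almost surely. *)
Definition cond_prob_ge (F : set (set T)) (E : set T) (p : R) : Prop :=
  exists2 g : T -> R, cond_prob_version F E g & {ae P, forall w, p <= g w}.

End Probability.

Section DirectSearch.
Context {d : measure_display} {T : measurableType d} {R : realType}.
Context {n m : nat}.
Implicit Types (f : 'rV[R]_n -> R) (rho : R -> R).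
Implicit Types (D : nat -> 'I_m -> T -> 'rV[R]_n).
Implicit Types (X : nat -> T -> 'rV[R]_n) (A : nat -> T -> R).

(* Only the values of rho on (0, +oo) matter. *)
Definition forcing_function rho : Prop :=
  [/\ forall a : R, 0 < a -> 0 < rho a,
      forall a b : R, 0 < a -> a <= b -> rho a <= rho b &
      rho =o_ (0^'+) (fun a : R => a)].

Definition sufficient_decrease f rho D X A (k : nat) (w : T) (i : 'I_m) :
    Prop :=
  f (X k w) - f (X k w + A k w *: D k i w) > rho (A k w).

(* The polling set of iteration k is {D k i w | i < m}. *)
Record pds f (x0 : 'rV[R]_n) (alpha0 theta gamma : R) rho D X A : Prop := {
  pds_random_D : forall k i, random_vector (D k i);
  pds_random_X : forall k, random_vector (X k);
  pds_random_A : forall k, measurable_fun setT (A k);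
  pds_unit : forall k i w, enorm (D k i w) = 1;
  pds_X0 : forall w, X 0%N w = x0;
  pds_A0 : forall w, A 0%N w = alpha0;
  pds_success : forall k w,
    (exists i, sufficient_decrease f rho D X A k w i) ->
    (exists2 i, sufficient_decrease f rho D X A k w i &
       X k.+1 w = X k w + A k w *: D k i w) /\
    A k.+1 w = gamma * A k w;
  pds_failure : forall k w,
    ~ (exists i, sufficient_decrease f rho D X A k w i) ->
    X k.+1 w = X k w /\ A k.+1 w = theta * A k w
}.

Definition sigma_polling D (k : nat) : set (set T) :=
  <<s \bigcup_(i in [set: 'I_m]) preimage_set_system setT (D k i) borel >>.

(* past D X k is F_{k-1} = sigma(D_0, X_1, ..., D_{k-1}, X_k); in particular
   past D X 0 is the trivial sigma-algebra. *)
Definition past D X (k : nat) : set (set T) :=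
  <<s \bigcup_(j in [set j | (j < k)%N])
        (sigma_polling D j `|` preimage_set_system setT (X j.+1) borel) >>.

Definition iid_uniform_polling (P : probability T R) D X : Prop :=
  forall k,
    [/\ forall i, uniform_on_sphere P (D k i),
        mutually_independent P (D k) &
        independent_sigma P (sigma_polling D k) (past D X k)].

Definition probabilistic_descent (P : probability T R) (cm0 : R) f D X
    (p kappa : R) : Prop :=
  forall k, cond_prob_ge P (past D X k)
    [set w | kappa <= cm cm0 (fun i => D k i w) (- gradient f (X k w))] p.

End DirectSearch.

(* Main.v *)
Require Import Defs.
From HB Require Import structures.
From mathcomp Require Import all_boot all_order all_algebra.
From mathcomp Require Import all_classical all_reals all_analysis.
From mathcomp Require Import measurable_realfun.
From mathcomp Require Import ring lra.

Set Implicit Arguments.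
Unset Strict Implicit.
Unset Printing Implicit Defensive.

Import Order.TTheory GRing.Theory Num.Theory.
Import numFieldNormedType.Exports.

Local Open Scope classical_set_scope.
Local Open Scope ring_scope.

(** Write [q] for the probability that the polling set of an iteration contains a
    useful direction, and let a step size factor be [gamma] with probability [q]
    and [theta] with probability [1 - q]. Its logarithm has mean
    [q ln gamma + (1 - q) ln theta], which has the sign of [q - p0]. A uniform
    direction has a positive component along a given vector with probability
    1/2, so that some direction out of [m] has one with probability [1 - 2^-m],
    and condition b says exactly that [1 - 2^-m > p0]. Since the threshold is
    not an integer, [1 - 2^-m < p0] when b fails.

    - Independence. The component [dot d u] of a uniform direction [d] along a
      unit vector [u] has a distribution that depends neither on [u]
      ([uniform_dot_rotation], by a reflection) nor on the uniform direction
      ([uniform_dot_unique], by Fubini's theorem), and its median is [0]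
      ([uniform_dot_le0]). As the directions of iteration [k] are independent of
      the past and the steepest descent direction at [X k] is determined by the
      past, the latter can be frozen ([freezing], [prob_all_in]): whatever the
      past, the event [hit I k] that some direction has its component along the
      steepest descent direction outside [I] has probability
      [1 - c(I)^m], with [c(I)] the probability of [I] for one component.

    - b implies c. By continuity from above ([comp_prob_lt_cvg]), the
      probability that some cosine is at least [kappa] is still larger than
      [p0] for [kappa > 0] small. Where the gradient vanishes the cosine measure
      is [cm0], which is why [kappa <= cm0] is required unless this event is
      negligible.

    - c implies b. The gradient at [x0] is not zero, and at iteration [0] the
      probability of descent is at most [1 - 2^-m].

    - b implies a. A direction whose cosine is at least [kappa] entails success
      as soon as the step size is small compared to the gradient
      ([success_of_descent]), and the step sizes always converge to [0]
      ([A_cvg0]). On a path where the gradients stay away from [0], the step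
      sizes therefore dominate a multiplicative random walk whose logarithm has
      positive drift, though they converge to [0]; this has probability zero
      ([liminf_eq0_ae]).

    - a implies b. By convexity a success requires a direction with a positive
      component along the steepest descent direction, so that the step sizes
      are dominated by a multiplicative random walk, whose logarithm has
      negative drift when b fails. With positive probability the first [J]
      iterations fail and the later step sizes have a sum as small as desired,
      and then the iterates remain near [x0], where the gradient does not vanish
      ([liminf_eq0_not_ae]).

    Both estimates on the random walk follow from the exponential Markov
    inequality [walk_markov], with the exponent of [exists_contraction]. *)

(** * Euclidean geometry of row vectors *)

Section Euclidean.
Context {R : realType} {n : nat}.
Implicit Types (u v w x y : 'rV[R]_n) (c : R).

Lemma dotC u v : dot u v = dot v u.
Proof. by apply: eq_bigr => i _; rewrite mulrC. Qed.

Lemma dotDl u v w : dot (u + v) w = dot u w + dot v w.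
Proof. by rewrite /dot -big_split; apply: eq_bigr => i _;
  rewrite mxE mulrDl. Qed.

Lemma dotZl c u v : dot (c *: u) v = c * dot u v.
Proof. by rewrite /dot mulr_sumr; apply: eq_bigr => i _; rewrite mxE mulrA. Qed.

Lemma dotNl u v : dot (- u) v = - dot u v.
Proof. by rewrite -scaleN1r dotZl mulN1r. Qed.

Lemma dotBl u v w : dot (u - v) w = dot u w - dot v w.
Proof. by rewrite dotDl dotNl. Qed.

Lemma dotDr u v w : dot u (v + w) = dot u v + dot u w.
Proof. by rewrite dotC dotDl !(dotC u). Qed.

Lemma dotZr c u v : dot u (c *: v) = c * dot u v.
Proof. by rewrite dotC dotZl dotC. Qed.

Lemma dotNr u v : dot u (- v) = - dot u v.
Proof. by rewrite dotC dotNl dotC. Qed.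

Lemma dotBr u v w : dot u (v - w) = dot u v - dot u w.
Proof. by rewrite dotDr dotNr. Qed.

Lemma dot0l v : dot 0 v = 0.
Proof. by rewrite -(scale0r v) dotZl mul0r. Qed.

Lemma dot_ge0 u : 0 <= dot u u.
Proof. by apply: sumr_ge0 => i _; rewrite -expr2 sqr_ge0. Qed.

Lemma dot_eq0 u : (dot u u == 0) = (u == 0).
Proof.
apply/idP/eqP => [|->]; last by rewrite dot0l.
rewrite psumr_eq0 => [/allP u0|i _]; last by rewrite -expr2 sqr_ge0.
apply/rowP => i; rewrite mxE; apply/eqP.
by have := u0 i (mem_index_enum i); rewrite -expr2 sqrf_eq0.
Qed.

Lemma dot_mulmx u v (Q : 'M[R]_n) : dot (u *m Q) v = dot u (v *m Q^T).
Proof.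
rewrite /dot; under eq_bigr do rewrite mxE mulr_suml.
rewrite exchange_big; apply: eq_bigr => i _; rewrite mxE mulr_sumr.
by apply: eq_bigr => j _; rewrite mxE mulrAC mulrA.
Qed.

Lemma enorm_ge0 u : 0 <= enorm u.
Proof. exact: sqrtr_ge0. Qed.

Lemma sqr_enorm u : enorm u ^+ 2 = dot u u.
Proof. by rewrite /enorm sqr_sqrtr // dot_ge0. Qed.

Lemma enorm_eq0 u : (enorm u == 0) = (u == 0).
Proof. by rewrite -dot_eq0 -sqr_enorm sqrf_eq0. Qed.

Lemma enorm_gt0 u : (0 < enorm u) = (u != 0).
Proof. by rewrite lt_neqAle enorm_ge0 andbT eq_sym enorm_eq0. Qed.

Lemma enorm0 : enorm (0 : 'rV[R]_n) = 0.
Proof. by apply/eqP; rewrite enorm_eq0. Qed.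

Lemma enormZ c u : enorm (c *: u) = `|c| * enorm u.
Proof.
by rewrite /enorm dotZl dotZr mulrA -expr2 sqrtrM ?sqr_ge0 // sqrtr_sqr.
Qed.

Lemma enormN u : enorm (- u) = enorm u.
Proof. by rewrite /enorm dotNl dotNr opprK. Qed.

Lemma dot_le_enorm u v : dot u v <= enorm u * enorm v.
Proof.
have [->|v0] := eqVneq v 0; first by rewrite dotC dot0l enorm0 mulr0.
have [->|u0] := eqVneq u 0; first by rewrite dot0l enorm0 mul0r.
rewrite -subr_ge0 -(pmulr_rge0 _ (_ : 0 < 2 * (enorm u * enorm v))); last first.
  by rewrite !mulr_gt0 ?enorm_gt0.
have := dot_ge0 (enorm v *: u - enorm u *: v).
rewrite !(dotBl, dotBr) !(dotZl, dotZr) (dotC v u) -!sqr_enorm => h.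
by apply: le_trans h _; rewrite le_eqVlt; apply/orP; left; apply/eqP; ring.
Qed.

Lemma enormD u v : enorm (u + v) <= enorm u + enorm v.
Proof.
rewrite -(@ler_pXn2r _ 2) ?nnegrE ?addr_ge0 ?enorm_ge0 //.
rewrite sqr_enorm dotDl !dotDr (dotC v u) -!sqr_enorm.
by have := dot_le_enorm u v; lra.
Qed.

Lemma enorm_sub_le u v : enorm u <= enorm v + enorm (u - v).
Proof. by rewrite -{1}(subrK v u) addrC; exact: enormD. Qed.

Lemma coord_le_enorm u i : `|u 0 i| <= enorm u.
Proof.
rewrite -(@ler_pXn2r _ 2) ?nnegrE ?enorm_ge0 // sqr_enorm real_normK ?num_real
  //.
rewrite /dot (bigD1 i) //= -expr2 lerDl.
by apply: sumr_ge0 => j _; rewrite -expr2 sqr_ge0.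
Qed.

Lemma enorm_le_sum u : enorm u <= \sum_(i < n) `|u 0 i|.
Proof.
rewrite -(@ler_pXn2r _ 2) ?nnegrE ?enorm_ge0 ?sumr_ge0 // sqr_enorm expr2.
rewrite mulr_suml; apply: ler_sum => i _.
apply: le_trans (ler_norm _) _; rewrite normrM ler_wpM2l //.
by rewrite (bigD1 i) //= lerDl sumr_ge0.
Qed.

(** A vector is carried to any other vector of the same norm by the reflection
    across the hyperplane orthogonal to their difference. *)
Lemma exists_reflection u v : enorm u = enorm v ->
  exists2 Q : 'M[R]_n, Q *m Q^T = 1%:M & Q^T = Q /\ u *m Q = v.
Proof.
move=> uv; have [<-|neq_uv] := eqVneq u v.
  by exists 1%:M; rewrite trmx1 ?mulmx1.
have [w wE] : exists w, w = u - v by exists (u - v).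
have w0 : dot w w != 0 by rewrite wE dot_eq0 subr_eq0.
have uvE : dot u u = dot v v by rewrite -!sqr_enorm uv.
have ww : w *m w^T = (dot w w)%:M.
  apply/matrixP => i j; rewrite !ord1 !mxE eqxx mulr1n /dot.
  by apply: eq_bigr => k _; rewrite mxE.
have uw : u *m w^T = (dot u w)%:M.
  apply/matrixP => i j; rewrite !ord1 !mxE eqxx mulr1n /dot.
  by apply: eq_bigr => k _; rewrite mxE.
pose Q : 'M[R]_n := 1%:M - (2 / dot w w) *: (w^T *m w).
have QT : Q^T = Q.
  by apply/matrixP => i j; rewrite !mxE eq_sym; congr (_ - _ * _);
    apply: eq_bigr => k _; rewrite !mxE mulrC.
exists Q; last split => //.
  set c := 2 / dot w w in Q QT *.
  have MM : (w^T *m w) *m (w^T *m w) = dot w w *: (w^T *m w).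
    by rewrite -mulmxA (mulmxA w) ww mul_scalar_mx -scalemxAr.
  rewrite QT /Q mulmxBl mul1mx mulmxBr mulmx1 -scalemxAl -scalemxAr MM !scalerA.
  have -> : c * c * dot w w = c + c by rewrite /c; field.
  by rewrite scalerDl opprB addrK subrK.
rewrite /Q mulmxBr mulmx1 -scalemxAr mulmxA uw mul_scalar_mx scalerA.
have -> : 2 / dot w w * dot u w = 1.
  apply: (mulIf w0); rewrite mul1r mulrAC divfK //.
  by rewrite wE !(dotBl, dotBr) (dotC v u) uvE; ring.
by rewrite scale1r wE opprB addrCA subrr addr0.
Qed.

End Euclidean.

(** * Differentiable and convex functions *)

Section Differentiable.
Context {R : realType} {n : nat}.
Variable f : 'rV[R]_n -> R.
Hypothesis df : forall x, differentiable f x.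
Implicit Types (x y v : 'rV[R]_n).

Lemma derive_gradient x v : 'D_v f x = dot (gradient f x) v.
Proof.
rewrite deriveE // {1}(matrix_sum_delta v) big_ord1 linear_sum.
apply: eq_bigr => i _; rewrite linearZ /= mxE deriveE //.
by rewrite mulrC.
Qed.

Lemma is_derive_line x v (t : R) :
  is_derive t 1 (fun s : R => f (x + s *: v))
    (dot (gradient f (x + t *: v)) v).
Proof.
rewrite -derive_gradient.
have dv : derivable f (x + t *: v) v by exact: diff_derivable.
have E : (fun h : R => h^-1 *: (((fun s : R => f (x + s *: v)) \o shift t) (h
  *: (1 : R)) -
      f (x + t *: v))) =
    (fun h : R => h^-1 *: ((f \o shift (x + t *: v)) (h *: v) - f (x + t *:
      v))).
  apply/funext => h /=; congr (_ *: (f _ - _)).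
  rewrite (_ : h *: (1 : R) = h); last exact: mulr1.
  by rewrite scalerDl addrCA.
by split; [rewrite /derivable E | rewrite /derive E].
Qed.

Lemma mean_value x v (a : R) : 0 < a ->
  exists2 c, 0 < c < a &
    f (x + a *: v) - f x = a * dot (gradient f (x + c *: v)) v.
Proof.
move=> a0.
have [|c] := @MVT R (fun s : R => f (x + s *: v))
    (fun s => dot (gradient f (x + s *: v)) v) 0 a a0
    (fun s _ => is_derive_line x v s).
  apply: continuous_subspaceT => s.
  apply: differentiable_continuous; apply/derivable1_diffP.
  by have [] := is_derive_line x v s.
rewrite in_itv /= => ca; rewrite scale0r addr0 subr0 mulrC => ->.
by exists c.
Qed.

Lemma convex_ge_tangent x y :
  convex_function (setT : set (convex_lmodType 'rV[R]_n)) f ->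
  f x + dot (gradient f x) (y - x) <= f y.
Proof.
move=> cf; rewrite addrC -lerBrDr -derive_gradient.
have dv : derivable f x (y - x) by exact: diff_derivable.
have /cvg_dnbhs_at_right cd := dv.
apply: (cvgr_to_le cd).
near=> h.
have h0 : 0 < h by near: h; exact: nbhs_right_gt.
have h1 : h <= 1 by near: h; exact: nbhs_right_le.
rewrite /= /GRing.scale /= mulrC ler_pdivrMr //.
have h01 : 0 <= h <= 1 by rewrite h1 ltW.
pose t : {i01 R} := Itv01 (ltW h0) h1.
have := cf t y x; rewrite !inE => /(_ I I).
rewrite convRE /=.
have -> : conv t (y : convex_lmodType 'rV[R]_n) x = h *: (y - x) + x.
  transitivity (h *: y + (1 - h) *: x) => //.
  by rewrite scalerBr scalerBl scale1r [x - _]addrC addrA.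
rewrite /unstable.onem; lra.
Unshelve. all: by end_near. Qed.

Lemma gradient_eq0_minimizer x :
  convex_function (setT : set (convex_lmodType 'rV[R]_n)) f ->
  gradient f x = 0 -> minimizers f x.
Proof.
move=> cf gx; have fx y : f x <= f y.
  by have := convex_ge_tangent x y cf; rewrite gx dot0l addr0.
rewrite /minimizers /=; apply/eqP; rewrite eq_le; apply/andP; split.
  by apply: lb_le_inf; [exists (f x), x | move=> _ [y _ <-]].
by apply: ge_inf; [exists (f x) => _ [y _ <-] | exists x].
Qed.

End Differentiable.

Section LipschitzGradient.
Context {R : realType} {n : nat}.

Lemma elipschitz_gt0 (g : 'rV[R]_n -> 'rV[R]_n) : elipschitz g ->
  exists2 L : R, 0 < L & forall x y, enorm (g x - g y) <= L * enorm (x - y).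
Proof.
move=> [L gL]; exists (`|L| + 1) => [|x y]; first by rewrite ltr_wpDl.
apply: le_trans (gL x y) _; rewrite ler_wpM2r ?enorm_ge0 //.
by apply: le_trans (ler_norm _) _; rewrite lerDl.
Qed.

Lemma elipschitz_coord_continuous (g : 'rV[R]_n -> 'rV[R]_n) i :
  elipschitz g -> continuous (fun x => g x 0 i).
Proof.
move=> /elipschitz_gt0[L L0 gL] x.
apply/(@cvgrPdist_le R R 'rV[R]_n (nbhs x) (nbhs_filter x)) => e e0.
have n0 : 0 < n%:R + 1 :> R by rewrite ltr_wpDl ?ler0n.
near=> y.
have xy : `|x - y| < e / (L * (n%:R + 1)).
  near: y; apply: (@cvgr_dist_lt R _ _ (nbhs x) _ id x _) => //.
  by rewrite divr_gt0 // mulr_gt0.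
have -> : g x 0 i - g y 0 i = (g x - g y) 0 i by rewrite !mxE.
apply: le_trans (coord_le_enorm _ _) _; apply: le_trans (gL _ _) _.
rewrite -ler_pdivlMl //; apply: le_trans (enorm_le_sum _) _.
apply: (@le_trans _ _ (\sum_(j < n) `|x - y|)).
  apply: ler_sum => j _; rewrite [leRHS]mx_normrE.
  exact: (le_bigmax _ (fun ij => `|(x - y) ij.1 ij.2|) (0, j)).
rewrite sumr_const card_ord -mulr_natl.
apply: (@le_trans _ _ ((n%:R + 1) * (e / (L * (n%:R + 1))))).
  by apply: ler_pM => //; [rewrite lerDl | exact: ltW].
by rewrite le_eqVlt; apply/orP; left; apply/eqP; field; rewrite !gt_eqF.
Unshelve. all: by end_near. Qed.

(** One step of length [a] along a unit vector; the constant is twice the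
    optimal one. *)
Lemma descent (f : 'rV[R]_n -> R) (L : R) x v (a : R) :
  (forall x, differentiable f x) -> 0 < L ->
  (forall x y, enorm (gradient f x - gradient f y) <= L * enorm (x - y)) ->
  0 < a -> enorm v = 1 ->
  f (x + a *: v) <= f x + a * dot (gradient f x) v + L * a ^+ 2.
Proof.
move=> df L0 gL a0 v1; have [c /andP[c0 ca] fE] := mean_value df x v a0.
rewrite -addrA -lerBlDl fE.
rewrite expr2 mulrCA -mulrDr ler_pM2l // -lerBlDl -dotBl.
apply: le_trans (dot_le_enorm _ _) _; rewrite v1 mulr1.
apply: le_trans (gL _ _) _; rewrite ler_pM2l //.
by rewrite addrC addKr enormZ v1 mulr1 gtr0_norm // ltW.
Qed.

End LipschitzGradient.

(** * Random vectors and independence *)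

Section RandomVectors.
Context {R : realType} {n : nat} {d : measure_display} {T : measurableType d}.
Implicit Types (X Y : T -> 'rV[R]_n).

Lemma random_vector_continuous X (g : 'rV[R]_n -> R) :
  random_vector X -> continuous g -> measurable_fun setT (g \o X).
Proof.
move=> mX /continuousP cg.
apply: (measurability _ (RGenOpens.measurableE R)) => _ [_ [a [b ->]] <-].
rewrite setTI comp_preimage; apply: mX.
by apply: sub_sigma_algebra; apply: cg; exact: interval_open.
Qed.

Lemma random_vector_coord X i :
  random_vector X -> measurable_fun setT (fun w => X w 0 i).
Proof.
move=> mX; apply: (random_vector_continuous mX (g := fun x => x 0 i)).
exact: coord_continuous.
Qed.

Lemma measurable_dot X Y :
  (forall i, measurable_fun setT (fun w => X w 0 i)) ->
  (forall i, measurable_fun setT (fun w => Y w 0 i)) ->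
  measurable_fun setT (fun w => dot (X w) (Y w)).
Proof. by move=> mX mY; apply: measurable_sum => i; exact: measurable_funM. Qed.

Lemma measurable_enorm X :
  (forall i, measurable_fun setT (fun w => X w 0 i)) ->
  measurable_fun setT (fun w => enorm (X w)).
Proof.
move=> mX; apply: (@measurableT_comp _ _ _ _ _ _ (@Num.sqrt R)).
  by apply: continuous_measurable_fun; exact: sqrt_continuous.
exact: measurable_dot.
Qed.

End RandomVectors.

Section BorelSets.
Context {R : realType} {n : nat}.

Lemma borel_dot (u : 'rV[R]_n) (I : set R) : measurable I ->
  borel [set x : 'rV[R]_n | I (dot x u)].
Proof.
move=> mI.
have := @measurable_dot R n _
  (g_sigma_algebraType [set A : set 'rV[R]_n | open A]) id (fun=> u).
move=> /(_ _ _ measurableT I mI); rewrite setTI; apply => i.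
  by apply: random_vector_coord => B.
exact: measurable_cst.
Qed.

End BorelSets.

Section Freezing.
Context {R : realType} {d : measure_display} {T : measurableType d}.
Variable P : probability T R.

(** The sigma-algebra generated by [G], as the measurable structure of [T]. *)
Local Notation sub G := (g_sigma_algebraType (T := T) G).

(** Freezing: let [S] depend on the outcome through two independent
    sigma-algebras. If its probability with the first dependence frozen at any
    outcome of an event [H] of the first sigma-algebra is [c], then [c] is its
    conditional probability given [H]. The law of the diagonal embedding of [T]
    into its square is the product of the two restrictions of [P]. *)
Lemma freezing (G1 G2 : set (set T)) (H : set T)
    (S : set (sub G1 * sub G2)) (c : R) :
  0 <= c ->
  <<s G1>> `<=` measurable -> <<s G2>> `<=` measurable ->
  independent_sigma P <<s G2>> <<s G1>> ->
  measurable S -> <<s G1>> H ->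
  (forall w, H w -> P [set w2 | S (w, w2)] = c%:E) ->
  P (H `&` [set w | S (w, w)]) = (c%:E * P H)%E.
Proof.
move=> c0 sG1 sG2 indep mS mH Sc.
have m1 : @measurable_fun _ _ T (sub G1) setT id.
  by move=> _ B /sG1 mB; rewrite setTI.
have m2 : @measurable_fun _ _ T (sub G2) setT id.
  by move=> _ B /sG2 mB; rewrite setTI.
have m12 : @measurable_fun _ _ T (sub G1 * sub G2)%type setT (fun w => (w, w)).
  exact: measurable_fun_pair.
pose f1 : {mfun T >-> sub G1} := HB.pack (id : T -> sub G1)
  (isMeasurableFun.Build _ _ _ _ _ m1).
pose f2 : {mfun T >-> sub G2} := HB.pack (id : T -> sub G2)
  (isMeasurableFun.Build _ _ _ _ _ m2).
pose f12 : {mfun T >-> (sub G1 * sub G2)%type} :=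
  HB.pack (fun w : T => (w, w) : sub G1 * sub G2)
  (isMeasurableFun.Build _ _ _ _ _ m12).
have joint := @product_measure_unique _ _ _ _ R
  (distribution P f1) (distribution P f2) (distribution P f12).
have {}joint : forall S' : set (sub G1 * sub G2), measurable S' ->
    (distribution P f1 \x distribution P f2)%E S' = distribution P f12 S'.
  apply: joint => A B mA mB.
  by rewrite /distribution /pushforward /= muleC -indep // setIC.
have mHT : @measurable _ (sub G1 * sub G2)%type (H `*` setT).
  by apply: measurableX => //; exact: measurableT.
have mHS : @measurable _ (sub G1 * sub G2)%type ((H `*` setT) `&` S).
  exact: measurableI.
transitivity (distribution P f12 ((H `*` setT) `&` S)).
  by rewrite /distribution /pushforward /=; congr (P _);
  apply/seteqP; split => w /=; [case | case; case].
rewrite -joint // /product_measure1.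
rewrite (eq_integral (fun w : sub G1 => (c%:E * (\1_H w)%:E)%E)); last first.
  move=> w _ /=; rewrite /distribution /pushforward /=.
  rewrite indicE; have [wH|wH] := pselect (H w).
    rewrite mem_set // mule1 -(Sc _ wH); congr (P _).
    apply/seteqP; split => w2 /=; rewrite /xsection /= inE.
      by case.
    by split.
  rewrite memNset // mule0 -[RHS](@measure0 _ _ _ P); congr (P _).
  by apply/seteqP; split => w2 //=; rewrite /xsection /= inE => -[[]].
rewrite ge0_integralZl_EFin //.
- by rewrite integral_indic // ?setIT.
by apply/measurable_EFinP; exact: measurable_indic.
Qed.

End Freezing.

(** * The uniform distribution on the sphere *)

Lemma sum_measure_le {R : realType} {d : measure_display} {T : measurableType d}
    (P : probability T R) (N K : nat) (E : 'I_N -> set T) :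
  (forall t, measurable (E t)) ->
  (forall w, (\sum_(t < N) (w \in E t) <= K)%N) ->
  (\sum_(t < N) P (E t) <= K%:R%:E)%E.
Proof.
move=> mE EK.
under eq_bigr do rewrite -[E _]setIT -integral_indic //.
rewrite -ge0_integral_sum //; last first.
  by move=> t; apply/measurable_EFinP; exact: measurable_indic.
apply: (@le_trans _ _ (\int[P]_(w in setT) (K%:R%:E))%E).
  apply: ge0_le_integral => //.
  - by move=> w _; apply: sume_ge0 => t _; rewrite lee_fin.
  - apply: emeasurable_sum => t.
    by apply/measurable_EFinP; exact: measurable_indic.
  - move=> w _; rewrite sumEFin lee_fin.
    by under eq_bigr do rewrite indicE; rewrite -natr_sum ler_nat.
by rewrite integral_cst // -[leRHS]mule1 lee_wpmul2l // probability_le1.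
Qed.

Section UniformDirection.
Context {R : realType} {n : nat} {d : measure_display} {T : measurableType d}.
Variable P : probability T R.
Implicit Types (X Y : T -> 'rV[R]_n) (u v : 'rV[R]_n) (I : set R).

Lemma measurable_dot_event X u I : random_vector X -> measurable I ->
  measurable [set w | I (dot (X w) u)].
Proof. by move=> mX mI; apply: (mX [set x | I (dot x u)]);
  exact: borel_dot. Qed.

Lemma uniform_dot_rotation X u v I :
  uniform_on_sphere P X -> measurable I -> enorm u = enorm v ->
  P [set w | I (dot (X w) u)] = P [set w | I (dot (X w) v)].
Proof.
move=> [_ uX] mI /exists_reflection[Q QQ [QT <-]].
rewrite -(uX Q QQ [set x | I (dot x u)]); last exact: borel_dot.
by congr (P _); apply/funext => w /=; rewrite dot_mulmx QT.
Qed.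

(** Any two uniform directions [X] and [Y] have the same distribution of their
    coordinate along a unit vector: by rotation invariance, each is the
    distribution of [dot X Y'] for an independent copy [Y'] of [Y]. *)
Lemma uniform_dot_unique X Y u I :
  random_vector X -> random_vector Y ->
  (forall w, enorm (X w) = 1) -> (forall w, enorm (Y w) = 1) ->
  uniform_on_sphere P X -> uniform_on_sphere P Y ->
  measurable I -> enorm u = 1 ->
  P [set w | I (dot (X w) u)] = P [set w | I (dot (Y w) u)].
Proof.
move=> mX mY X1 Y1 uX uY mI u1.
pose S : set (T * T) := [set z | I (dot (X z.1) (Y z.2))].
have mS : measurable S.
  rewrite -[S]setTI; apply: (measurable_dot (X := X \o fst) (Y := Y \o snd)) =>
    //= i.
    by apply: (measurableT_comp (f := fun w => X w 0 i)) => //;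
      exact: random_vector_coord.
  by apply: (measurableT_comp (f := fun w => Y w 0 i)) => //;
    exact: random_vector_coord.
have := product_measure_unique (@product_measure2E _ _ _ _ R P P) mS.
rewrite /product_measure1 /product_measure2.
rewrite (eq_integral (fun=> P [set w | I (dot (Y w) u)])); last first.
  move=> w _ /=.
  rewrite (uniform_dot_rotation uY mI (u := u) (v := X w)) ?X1 //.
  congr (P _); apply/seteqP; split => z; rewrite /xsection /= inE dotC //.
rewrite [X in _ = X -> _](eq_integral (fun=> P [set w | I (dot (X w) u)]));
  last first.
  move=> w _ /=.
  rewrite (uniform_dot_rotation uX mI (u := u) (v := Y w)) ?Y1 //.
  by congr (P _); apply/seteqP; split => z; rewrite /ysection /= inE.
rewrite !integral_cst // => /esym.
have PT : P setT = 1%E := probability_setT P.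
by move=> XY; rewrite -[LHS]mule1 -[RHS]mule1 -PT; exact: XY.
Qed.

(** Great subspheres are null: the points of the moment curve
    [t |-> (1, t, .., t^(n-1))] are equally likely to be orthogonal to [X],
    and a unit vector is orthogonal to fewer than [n] of them. *)
Lemma uniform_dot_eq0 X u : (0 < n)%N ->
  random_vector X -> (forall w, enorm (X w) = 1) -> uniform_on_sphere P X ->
  u != 0 -> P [set w | dot (X w) u = 0] = 0%E.
Proof.
move=> n0 mX X1 uX u0.
have m0 : measurable [set (0 : R)] by exact: measurable_set1.
have mE v : measurable [set w | dot (X w) v = 0].
  exact: (measurable_dot_event v mX m0).
pose v (t : nat) : 'rV[R]_n := \row_j (t%:R ^+ j).
have v0 t : v t != 0.
  apply/eqP => /rowP /(_ (Ordinal n0)); rewrite !mxE expr0 => /eqP.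
  by rewrite oner_eq0.
have Pv t : P [set w | dot (X w) (v t) = 0] = P [set w | dot (X w) u = 0].
  have uv : enorm u = enorm ((enorm u / enorm (v t)) *: v t).
    by rewrite enormZ ger0_norm ?divr_ge0 ?enorm_ge0 // divfK // enorm_eq0.
  rewrite (uniform_dot_rotation uX m0 uv).
  congr (P _); apply/seteqP; split => w /=; rewrite dotZr.
    by move=> ->; rewrite mulr0.
  by move/eqP; rewrite !mulf_eq0 invr_eq0 !enorm_eq0 (negbTE u0) (negbTE (v0
    t)) => /eqP.
have [r rE] : exists r, P [set w | dot (X w) u = 0] = r%:E.
  by exists (fine (P [set w | dot (X w) u = 0]));
    rewrite fineK // fin_num_measure.
have r0 : 0 <= r by rewrite -lee_fin -rE.
have bound N : N%:R * r <= n%:R.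
  have := @sum_measure_le R d T P N n (fun t => [set w | dot (X w) (v t) = 0])
    (fun t => mE (v t)).
  rewrite (eq_bigr (fun=> r%:E)) => [|t _]; last by rewrite Pv.
  rewrite sumEFin lee_fin sumr_const card_ord mulr_natl => h; apply: h => w.
  pose p : {poly R} := \poly_(j < n) (if (insub j : option 'I_n) is Some i then
    X w 0 i else 0).
  have pE t : p.[t%:R] = dot (X w) (v t).
    rewrite horner_poly /dot; apply: eq_bigr => j _.
    by rewrite (insubT (fun k => k < n)%N (ltn_ord j)) mxE;
      congr (X w 0 _ * _); exact: val_inj.
  have p0 : p != 0.
    apply/eqP => p0; have : X w = 0.
      apply/rowP => i; rewrite mxE;
        have := congr1 (fun q : {poly R} => q`_i) p0.
      rewrite coef_poly coef0 ltn_ord (insubT (fun k => k < n)%N (ltn_ord i))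
        => <-.
      by congr (X w 0 _); exact: val_inj.
    by move/eqP; rewrite -enorm_eq0 X1 oner_eq0.
  pose s : seq R := 
    [seq t%:R | t : 'I_N <- enum 'I_N & w \in [set w | dot (X w) (v t) = 0]].
  have <- : size s = (\sum_(t < N)
      (w \in [set w | dot (X w) (v t) = 0%R]))%N.
    by rewrite size_map size_filter -sum1_count big_enum_cond /= -big_mkcond.
  have us : uniq s.
    rewrite map_inj_uniq => [|t t' /eqP];
      first exact: filter_uniq (enum_uniq _).
    by rewrite eqr_nat => /eqP /val_inj.
  have rs : all (root p) s.
    by apply/allP => _ /mapP[t + ->];
      rewrite mem_filter => /andP[/set_mem /= E0 _]; rewrite /root pE E0.
  apply: ltnW; apply: leq_trans (max_poly_roots p0 rs us) _.
  exact: size_poly.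
rewrite rE; congr _%:E; apply/eqP; rewrite eq_le r0 andbT leNgt;
  apply/negP => r1.
have := archi_boundP (divr_ge0 (ler0n R n) (ltW r1)).
by rewrite ltr_pdivrMr // ltNge bound.
Qed.

Lemma uniform_dot_le0 X u : (0 < n)%N ->
  random_vector X -> (forall w, enorm (X w) = 1) -> uniform_on_sphere P X ->
  u != 0 -> P [set w | dot (X w) u <= 0] = (2^-1)%:E.
Proof.
move=> n0 mX X1 uX u0.
have mle : measurable [set x : R | x <= 0] by rewrite -set_itvNyc.
have mlt : measurable [set x : R | x < 0] by rewrite -set_itvNyo.
have m1 := measurable_dot_event u mX mle.
have m2 := measurable_dot_event u mX mlt.
have m3 := measurable_dot_event u mX (measurable_set1 (0 : R)).
have E1 : P [set w | dot (X w) u <= 0] = P [set w | dot (X w) u < 0].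
  rewrite (_ : [set w | dot (X w) u <= 0] =
      [set w | dot (X w) u < 0] `|` [set w | dot (X w) u = 0]).
    rewrite measureU //= ?uniform_dot_eq0 // ?adde0 //.
    by apply/seteqP; split => w //= -[+ h]; rewrite h ltxx.
  apply/seteqP; split => w /=; rewrite le_eqVlt.
    by move=> /orP[/eqP|]; [right|left].
  by case=> [->|->]; rewrite ?orbT ?eqxx.
have E2 : P [set w | dot (X w) u < 0] = P (~` [set w | dot (X w) u <= 0]).
  rewrite (uniform_dot_rotation uX mlt (v := - u)) ?enormN //.
  congr (P _); apply/seteqP; split => w /=; rewrite dotNr oppr_lt0.
    by rewrite ltNge => /negP.
  by move=> /negP; rewrite -ltNge.
have := probability_setC P m1; rewrite -E2 -E1.
have : P [set w | dot (X w) u <= 0] \is a fin_num by exact: fin_num_measure.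
case: (P [set w | dot (X w) u <= 0]) => //= r _ [] rE; congr _%:E.
lra.
Qed.

End UniformDirection.

(** * Polling directions seen from the past *)

(** The normalization of [v], with a conventional value [e] at [v = 0]. *)
Definition unit_dir {R : realType} {n : nat} (e v : 'rV[R]_n) : 'rV[R]_n :=
  if v == 0 then e else (enorm v)^-1 *: v.

Lemma enorm_unit_dir {R : realType} {n : nat} (e v : 'rV[R]_n) :
  enorm e = 1 -> enorm (unit_dir e v) = 1.
Proof.
rewrite /unit_dir; case: eqVneq => // v0 _.
by rewrite enormZ ger0_norm ?invr_ge0 ?enorm_ge0 // mulVf // enorm_eq0.
Qed.

Lemma dot_unit_dir {R : realType} {n : nat} (e u v : 'rV[R]_n) : v != 0 ->
  dot u (unit_dir e v) = dot u v / enorm v.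
Proof. by move=> /negbTE v0; rewrite /unit_dir v0 dotZr mulrC. Qed.

Section Polling.
Context {d : measure_display} {T : measurableType d} {R : realType}.
Context {n m : nat}.
Variables (P : probability T R) (D : nat -> 'I_m -> T -> 'rV[R]_n).
Variables (X : nat -> T -> 'rV[R]_n) (x0 : 'rV[R]_n).
Hypothesis mD : forall k i, random_vector (D k i).
Hypothesis D1 : forall k i w, enorm (D k i w) = 1.
Hypothesis mX : forall k, random_vector (X k).
Hypothesis X0 : forall w, X 0%N w = x0.

(** Generators of [past D X k] and of [sigma_polling D k]. *)
Definition past_gen (k : nat) : set (set T) :=
  \bigcup_(j in [set j | (j < k)%N])
    (sigma_polling D j `|` preimage_set_system setT (X j.+1) borel).

Definition polling_gen (k : nat) : set (set T) :=
  \bigcup_(i in [set: 'I_m]) preimage_set_system setT (D k i) borel.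

Local Notation past_type k := (g_sigma_algebraType (past_gen k)).
Local Notation polling_type k := (g_sigma_algebraType (polling_gen k)).

Lemma sigma_polling_measurable k : sigma_polling D k `<=` measurable.
Proof.
apply: smallest_sub; first exact: sigma_algebra_measurable.
by move=> _ [i _ [B mB <-]]; rewrite setTI; exact: mD.
Qed.

Lemma past_measurable k : past D X k `<=` measurable.
Proof.
apply: smallest_sub; first exact: sigma_algebra_measurable.
move=> A [j _ [/sigma_polling_measurable //|[B mB <-]]].
by rewrite setTI; exact: mX.
Qed.

Lemma past_le k l : (k <= l)%N -> past D X k `<=` past D X l.
Proof.
move=> kl; apply: sub_sigma_algebra2 => A [j /= jk HA].
by exists j => //=; exact: leq_trans kl.
Qed.

Lemma past_D k i : random_vector (T := past_type k.+1) (D k i).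
Proof.
move=> B mB; apply: sub_sigma_algebra; exists k => /=; first exact: ltnSn.
by left; apply: sub_sigma_algebra; exists i => //; exists B => //;
  rewrite setTI.
Qed.

Lemma past_X k : random_vector (T := past_type k) (X k).
Proof.
case: k => [|k] B mB.
  have [x0B|x0B] := pselect (B x0).
    rewrite (_ : X 0%N @^-1` B = setT); first exact: measurableT.
    by apply/seteqP; split => w //= _; rewrite X0.
  rewrite (_ : X 0%N @^-1` B = set0); first exact: measurable0.
  by apply/seteqP; split => w //=; rewrite X0.
apply: sub_sigma_algebra; exists k => /=; first exact: ltnSn.
by right; exists B => //; rewrite setTI.
Qed.

Lemma polling_D k i : random_vector (T := polling_type k) (D k i).
Proof.
by move=> B mB; apply: sub_sigma_algebra; exists i => //; exists B => //;
  rewrite setTI.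
Qed.

Lemma past_measurable_fun k l d' (T' : measurableType d') (g : T -> T') :
  (k <= l)%N -> measurable_fun (T := past_type k) setT g ->
  measurable_fun (T := past_type l) setT g.
Proof. by move=> kl mg _ B mB; apply: (past_le kl); exact: mg. Qed.

Variables (g : 'rV[R]_n -> 'rV[R]_n) (e : 'rV[R]_n) (i0 : 'I_m).
Hypothesis g_lip : elipschitz g.
Hypothesis e1 : enorm e = 1.
Hypothesis hunif : iid_uniform_polling P D X.

(** The normalized steepest descent direction at iteration [k], where [g] is the
    gradient. *)
Definition dir (k : nat) (w : T) : 'rV[R]_n := unit_dir e (- g (X k w)).

Lemma past_g k i : measurable_fun (T := past_type k) setT (fun w => g (X k w) 0
  i).
Proof.
apply: (@random_vector_continuous R n _ (past_type k) (X k) (fun x => g x 0 i)).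
  exact: past_X.
exact: elipschitz_coord_continuous.
Qed.

Lemma past_g_eq0 k : past D X k [set w | g (X k w) = 0].
Proof.
have := @measurable_enorm R n _ (past_type k) (fun w => g (X k w)) (@past_g k).
move=> /(_ measurableT [set 0] (measurable_set1 _)); rewrite setTI.
congr (past D X k _); apply/seteqP; split => w /=; last by move=> ->;
  rewrite enorm0.
by move/eqP; rewrite enorm_eq0 => /eqP.
Qed.

Lemma past_dir k i : measurable_fun (T := past_type k) setT (fun w => dir k w 0
  i).
Proof.
have -> : (fun w => dir k w 0 i) = (fun w => if g (X k w) == 0 then e 0 i
    else (enorm (g (X k w)))^-1 * - g (X k w) 0 i).
  apply/funext => w; rewrite /dir /unit_dir oppr_eq0 enormN.
  by case: ifP => // _; rewrite !mxE.
apply: measurable_fun_ifT.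
- apply: (measurable_fun_bool true); rewrite setTI.
  rewrite (_ : _ @^-1` _ = [set w | g (X k w) = 0]); first exact: past_g_eq0.
  by apply/seteqP; split => w /= /eqP.
- exact: measurable_cst.
apply: measurable_funM.
  under eq_fun do rewrite -powR_inv1 ?enorm_ge0 //.
  apply: (@measurableT_comp _ _ _ _ _ _ (@powR R ^~ (-1))) => //.
  by apply: measurable_enorm; exact: past_g.
by apply: measurableT_comp => //; exact: past_g.
Qed.

(** All polling directions of iteration [k] have their component along the
    steepest descent direction [dir k] in [I]. *)
Definition all_in (I : set R) (k : nat) : set T :=
  [set w | forall i, I (dot (D k i w) (dir k w))].

Lemma past_all_in I k : measurable I -> past D X k.+1 (all_in I k).
Proof.
move=> mI; rewrite (_ : all_in I k =
    \bigcap_(i in [set: 'I_m]) [set w | I (dot (D k i w) (dir k w))]);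
      last first.
  by apply/seteqP; split => [w h i _|w h i]; [exact: h | exact: (h i)].
apply: (@fin_bigcap_measurable _ (past_type k.+1)) => [|i _].
  exact: finite_finset.
rewrite -[X in measurable X]setTI.
apply: (@measurable_dot R n _ (past_type k.+1)) => // j.
  by apply: random_vector_coord; exact: past_D.
by apply: (past_measurable_fun (leqnSn k)); exact: past_dir.
Qed.

(** The probability that a given polling direction has its component along a
    given unit vector in [I]; it depends neither on the iteration, nor on the
    direction, nor on the vector. *)
Definition comp_prob (I : set R) : R :=
  fine (P [set w | I (dot (D 0%N i0 w) e)]).

Lemma comp_probE I k i u : measurable I -> enorm u = 1 ->
  P [set w | I (dot (D k i w) u)] = (comp_prob I)%:E.
Proof.
move=> mI u1; rewrite /comp_prob fineK; last first.
  by apply: fin_num_measure; exact: measurable_dot_event.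
have [uk _ _] := hunif k; have [uz _ _] := hunif 0.
rewrite (uniform_dot_rotation (uk i) mI (v := e)) ?u1 ?e1 //.
exact: uniform_dot_unique.
Qed.

Lemma prob_all_in I k H : measurable I -> past D X k H ->
  P (H `&` all_in I k) = ((comp_prob I ^+ m)%:E * P H)%E.
Proof.
move=> mI mH; have [_ indepD indepF] := hunif k.
apply: (@freezing R d T P (past_gen k) (polling_gen k) H
  [set z | forall i, I (dot (D k i z.2) (dir k z.1))]) => //.
- by rewrite exprn_ge0 // fine_ge0.
- exact: past_measurable.
- exact: sigma_polling_measurable.
- rewrite (_ : [set z | _] = \bigcap_(i in [set: 'I_m])
    [set z : past_type k * polling_type k | I (dot (D k i z.2) (dir k z.1))]).
    apply: fin_bigcap_measurable => [|i _]; first exact: finite_finset.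
    rewrite -[X in measurable X]setTI.
    apply: (@measurable_dot R n _ (past_type k * polling_type k)%type
      (D k i \o snd) (dir k \o fst)) => //= j.
      apply: (@measurableT_comp _ _ _ _ (polling_type k) _ (fun w => D k i w 0
        j)).
        by apply: random_vector_coord; exact: polling_D.
      exact: measurable_snd.
    apply: (@measurableT_comp _ _ _ _ (past_type k) _ (fun w => dir k w 0 j)).
      exact: past_dir.
    exact: measurable_fst.
  by apply/seteqP; split => [w h i _|w h i]; [exact: h | exact: (h i)].
move=> w _; have := indepD [set: 'I_m]%SET
  (fun=> [set x | I (dot x (dir k w))]) (fun=> borel_dot _ mI).
rewrite (eq_bigr (fun=> (comp_prob I)%:E)) => [|i _]; last first.
  by apply: comp_probE => //; exact: enorm_unit_dir.
rewrite prodEFin prodr_const cardsT card_ord => <-; congr (P _).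
by apply/seteqP; split => [w' h i _|w' h i]; [exact: h | apply: (h i);
  rewrite /= inE].
Qed.

End Polling.

(** * A multiplicative random walk *)

Section Walk.
Context {R : realType} {d : measure_display} {T : measurableType d}.

(** The product of [u] over the times of [J, J + j[ at which the event [Y]
    occurs and of [l] over the other ones. *)
Definition walk (Y : nat -> set T) (u l : R) (J j : nat) (w : T) : R :=
  \prod_(i < j) (if w \in Y (J + i)%N then u else l).

Variables (P : probability T R) (F : nat -> set (set T)) (Y : nat -> set T).
Variable q : R.
Hypothesis F_measurable : forall k, F k `<=` measurable.
Hypothesis F_Y : forall k H, F k H -> F k.+1 (H `&` Y k).
Hypothesis F_nY : forall k H, F k H -> F k.+1 (H `&` ~` Y k).
Hypothesis mY : forall k, measurable (Y k).
Hypothesis P_Y : forall k H, F k H -> P (H `&` Y k) = (q%:E * P H)%E.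
Implicit Types (u l t : R).

Lemma walk0 u l J w : walk Y u l J 0 w = 1.
Proof. by rewrite /walk big_ord0. Qed.

Lemma walkSl u l J j w :
  walk Y u l J j.+1 w = (if w \in Y J then u else l) * walk Y u l J.+1 j w.
Proof.
rewrite /walk big_ord_recl addn0; congr (_ * _); apply: eq_bigr => i _.
by rewrite addSnnS.
Qed.

Lemma walkSr u l J j w :
  walk Y u l J j.+1 w = walk Y u l J j w * (if w \in Y (J + j)%N then u else l).
Proof. by rewrite /walk big_ord_recr. Qed.

Lemma walk_gt0 u l J j w : 0 < u -> 0 < l -> 0 < walk Y u l J j w.
Proof. by move=> u0 l0; apply: prodr_gt0 => i _; case: ifP. Qed.

Lemma walk_powR u l s J j w : 0 < u -> 0 < l ->
  walk Y (u `^ s) (l `^ s) J j w = walk Y u l J j w `^ s.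
Proof.
move=> u0 l0; elim: j => [|j IH]; first by rewrite !walk0 powR1.
rewrite !walkSr IH powRM ?ltW ?walk_gt0 //; last by case: ifP.
by case: ifP.
Qed.

Lemma measurable_walk_ge u l t J j : measurable [set w | t <= walk Y u l J j w].
Proof.
have mw : measurable_fun setT (walk Y u l J j).
  apply: measurable_prod => i _; apply: measurable_fun_ifT => //.
  apply: (measurable_fun_bool true); rewrite setTI.
  rewrite (_ : _ @^-1` _ = Y (J + i)%N) //.
  by apply/seteqP; split => w /= Yw; [exact: set_mem | exact: mem_set].
by have := mw measurableT _ (measurable_itv `[t, +oo[); rewrite setTI set_itvcy.
Qed.

Lemma P_nY k H : F k H -> P (H `&` ~` Y k) = ((1 - q)%:E * P H)%E.
Proof.
move=> FH; have mH := F_measurable FH.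
have PH : P H \is a fin_num by exact: fin_num_measure.
rewrite -setDE measureD //=; last by rewrite ltey_eq PH.
by rewrite P_Y // -(fineK PH) -!EFinM -EFinB mulrBl mul1r.
Qed.

(** An exponential Markov inequality, proved by conditioning on the first step:
    each step multiplies the bound by the mean [q u + (1 - q) l] of a factor. *)
Lemma walk_markov u l t J j H : 0 < u -> 0 < l -> 0 < t -> F J H ->
  (P (H `&` [set w | (t <= walk Y u l J j w)%R]) <=
   (t^-1 * (q * u + (1 - q) * l) ^+ j)%:E * P H)%E.
Proof.
move=> u0 l0; elim: j J t H => [|j IH] J t H t0 FH.
  rewrite expr0 mulr1; have mH := F_measurable FH.
  have [t1|t1] := leP t 1.
    apply: (@le_trans _ _ (P H)).
      by apply: le_measure; rewrite ?inE //;
        exact: measurableI (measurable_walk_ge _ _ _ _ _).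
    rewrite -[leLHS]mul1e lee_wpmul2r // lee_fin.
    by rewrite invf_ge1.
  rewrite (_ : H `&` _ = set0).
    by rewrite measure0 mule_ge0 // lee_fin invr_ge0 ltW.
  by apply/seteqP; split => w //= [_]; rewrite walk0 leNgt t1.
set A := [set w | t <= _].
have mA : measurable A by exact: measurable_walk_ge.
have mH := F_measurable FH.
have HA : H `&` A = ((H `&` Y J) `&` [set w | t / u <= walk Y u l J.+1 j w]) `|`
    ((H `&` ~` Y J) `&` [set w | t / l <= walk Y u l J.+1 j w]).
  apply/seteqP; split => w; rewrite /A /= walkSl !ler_pdivrMr // !(mulrC _
    (walk _ _ _ _ _ _)).
    by move=> [Hw]; case: ifP; [rewrite inE; left | move=> /negP; rewrite inE;
      right].
  by case=> -[[Hw Yw]]; [rewrite mem_set | rewrite memNset].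
rewrite HA; apply: le_trans (measureU2 _ _ _) _.
- apply: measurableI (measurable_walk_ge _ _ _ _ _); exact: measurableI.
- apply: measurableI (measurable_walk_ge _ _ _ _ _).
  by apply: measurableI => //; exact: measurableC.
apply: le_trans (leeD (IH _ _ _ (divr_gt0 t0 u0) (F_Y FH)) (IH _ _ _ (divr_gt0
  t0 l0) (F_nY FH))) _.
have PH : P H \is a fin_num by exact: fin_num_measure.
rewrite P_Y // P_nY // -(fineK PH) -!EFinM -EFinD lee_fin le_eqVlt.
apply/orP; left; apply/eqP.
by rewrite exprS !invf_div; field; exact: lt0r_neq0.
Qed.

End Walk.

(** * Paths of direct search *)

Section Paths.
Context {d : measure_display} {T : measurableType d} {R : realType}.
Context {n m : nat}.
Variables (f : 'rV[R]_n -> R) (x0 : 'rV[R]_n) (alpha0 theta gamma : R).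
Variables (rho : R -> R) (D : nat -> 'I_m -> T -> 'rV[R]_n).
Variables (X : nat -> T -> 'rV[R]_n) (A : nat -> T -> R).
Hypothesis halpha0 : 0 < alpha0.
Hypothesis htheta : 0 < theta < 1.
Hypothesis hgamma : 1 < gamma.
Hypothesis hrho : forcing_function rho.
Hypothesis hpds : pds f x0 alpha0 theta gamma rho D X A.
Local Notation g := (gradient f).

Definition success (k : nat) (w : T) : Prop :=
  exists i, sufficient_decrease f rho D X A k w i.

Let theta0 : 0 < theta. Proof. by case/andP: htheta. Qed.
Let theta1 : theta < 1. Proof. by case/andP: htheta. Qed.
Let gamma0 : 0 < gamma. Proof. exact: lt_trans hgamma. Qed.

Lemma A_success k w : success k w -> A k.+1 w = gamma * A k w.
Proof. by move=> /(pds_success hpds)[]. Qed.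

Lemma A_failure k w : ~ success k w -> A k.+1 w = theta * A k w.
Proof. by move=> /(pds_failure hpds)[]. Qed.

Lemma A_gt0 k w : 0 < A k w.
Proof.
elim: k => [|k IH]; first by rewrite (pds_A0 hpds).
have [s|s] := pselect (success k w).
  by rewrite A_success // mulr_gt0.
by rewrite A_failure // mulr_gt0.
Qed.

Lemma A_lower k w : alpha0 * theta ^+ k <= A k w.
Proof.
elim: k => [|k IH]; first by rewrite (pds_A0 hpds) expr0 mulr1.
have [s|s] := pselect (success k w).
  rewrite A_success // exprSr mulrA mulrC; apply: ler_pM => //.
  - exact: ltW.
  - by rewrite mulr_ge0 ?exprn_ge0 // ltW.
  - exact: ltW (lt_trans theta1 hgamma).
by rewrite A_failure // exprS mulrCA ler_pM2l.
Qed.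

Lemma f_success k w : success k w -> f (X k.+1 w) < f (X k w) - rho (A k w).
Proof.
move=> /(pds_success hpds)[[i + ->] _]; rewrite /sufficient_decrease; lra.
Qed.

Lemma f_nonincreasing w : nonincreasing_seq (fun k => f (X k w)).
Proof.
apply/nonincreasing_seqP => k; have [s|s] := pselect (success k w).
  have [rho0 _ _] := hrho.
  by have := f_success s; have := rho0 _ (A_gt0 k w); lra.
by have [-> _] := pds_failure hpds s.
Qed.

(** The step sizes converge to [0] on every path: a step size that stays large
    would entail infinitely many decreases of [f] by a fixed amount. *)
Lemma A_cvg0 w e : has_lbound (range f) -> 0 < e ->
  exists K, forall k, (K <= k)%N -> A k w <= e.
Proof.
move=> [l fl] e0; pose e' := e / gamma; have e'0 : 0 < e' by rewrite divr_gt0.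
have [rho0 rho_le _] := hrho.
have fcvg : cvgn (fun k => f (X k w)).
  apply: nonincreasing_is_cvgn; first exact: f_nonincreasing.
  by exists l => _ [k _ <-]; apply: fl; exists (X k w).
have [K1 fail] : exists K, forall k, (K <= k)%N -> e' <= A k w -> ~ success k w.
  have /cvgrPdist_lt/(_ _ (rho0 _ e'0))[K _ KP] := fcvg.
  exists K => k Kk ek s; have /= := KP k Kk; rewrite ltr_norml => /andP[h1 _].
  have /= h2 := nonincreasing_cvgn_ge (f_nonincreasing w) fcvg k.+1.
  have h3 := f_success s; have h4 := rho_le _ _ e'0 ek.
  by move: h1 h2 h3 h4; set L := lim _; lra.
(* below e' a step size can at most be multiplied by gamma *)
have stay k : (K1 <= k)%N -> A k w <= e -> A k.+1 w <= e.
  move=> Kk Ae; have [s|s] := pselect (success k w); last first.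
    rewrite A_failure //; apply: le_trans Ae.
    by rewrite ger_pMl ?A_gt0 // ltW.
  rewrite A_success // -ler_pdivlMl // mulrC.
  by rewrite leNgt; apply/negP => /ltW /(fail _ Kk).
have [K2 K12 AK2] : exists2 K, (K1 <= K)%N & A K w <= e.
  apply: contrapT => big.
  have Abig k : (K1 <= k)%N -> e < A k w.
    by move=> Kk; rewrite ltNge; apply/negP => h; apply: big; exists k.
  have ee' : e' <= e by rewrite /e' ler_pdivrMr // ler_peMr // ltW.
  have geo j : A (K1 + j)%N w = A K1 w * theta ^+ j.
    elim: j => [|j IH]; first by rewrite addn0 expr0 mulr1.
    rewrite addnS A_failure ?IH ?exprS; first by rewrite mulrCA.
    by apply: fail; rewrite ?leq_addr // (le_trans ee') // ltW // Abig //
      leq_addr.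
  have : (fun j => A K1 w * theta ^+ j) @ \oo --> A K1 w * 0.
    by apply: cvgMr; apply: cvg_expr; rewrite gtr0_norm.
  rewrite mulr0 => /cvgrPdist_lt/(_ _ e0)[j _ /(_ j (leqnn j))] /=.
  rewrite sub0r normrN -geo gtr0_norm ?A_gt0 // ltNge => /negP; apply.
  by apply: ltW; apply: Abig; rewrite leq_addr.
exists K2 => k; elim: k => [|k IH] Kk.
  by move: Kk AK2; rewrite leqn0 => /eqP ->.
move: Kk; rewrite leq_eqVlt => /orP[/eqP <- //|Kk].
by apply: stay (IH Kk); exact: leq_trans K12 Kk.
Qed.

(** A polling direction whose cosine with the steepest descent direction is at
    least [kappa] ensures success as long as the gradient is bounded away from
    [0] and the step size is small. *)
Lemma success_of_descent (e kappa : R) :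
  (forall x, differentiable f x) -> elipschitz g -> 0 < e -> 0 < kappa ->
  exists2 a, 0 < a & forall k w i, e <= enorm (g (X k w)) -> A k w <= a ->
    dot (D k i w) (g (X k w)) <= - (kappa * enorm (g (X k w))) -> success k w.
Proof.
move=> df /elipschitz_gt0[L L0 gL] e0 k0; have [_ _ rho_o] := hrho.
have c0 : 0 < kappa * e / 3 by rewrite divr_gt0 ?mulr_gt0.
have /eqoP/(_ _ c0) rho_c := rho_o.
have [b b0 bP] : exists2 b : R, 0 < b &
    forall a, 0 < a -> a < b -> rho a <= kappa * e / 3 * a.
  case: rho_c => b /= b0 bP; exists b => // a a0 ab.
  have := bP a; rewrite /ball_ /= sub0r normrN gtr0_norm // => /(_ ab a0).
  by apply: le_trans; exact: ler_norm.
exists (Num.min (b / 2) (kappa * e / 3 / L)) => [|k w i ge].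
  by rewrite lt_min !divr_gt0 // ?mulr_gt0.
rewrite le_min => /andP[Ab AL] Dg; exists i; rewrite /sufficient_decrease.
have A0 := A_gt0 k w.
have h2 := descent (X k w) df L0 gL A0 (pds_unit hpds k i w).
have bb : b / 2 < b by lra.
have h1 := bP _ A0 (le_lt_trans Ab bb).
have h3 : A k w * dot (g (X k w)) (D k i w) <= A k w * - (kappa * e).
  rewrite ler_pM2l // dotC; apply: le_trans Dg _.
  by rewrite lerN2 ler_pM2l.
have h4 : L * A k w ^+ 2 <= kappa * e / 3 * A k w.
  by move: AL; rewrite ler_pdivlMr // expr2 mulrA (mulrC L) => h;
    rewrite ler_pM2r.
have zE : kappa * e / 3 * A k w = kappa * e * A k w / 3 by rewrite mulrAC.
rewrite zE in h1 h4; rewrite mulrN (mulrC (A k w) (kappa * e)) in h3.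
have : 0 < kappa * e * A k w by rewrite !mulr_gt0.
move: h1 h2 h3 h4; clear.
move: (f _) (f _) (rho _) (A k w * _) (L * _) (kappa * e * _) => f1 f2 r p q z.
lra.
Qed.

(** A convex function does not decrease along a direction that has a nonnegative
    component along its gradient, so that success requires a direction with a
    negative one. *)
Lemma descent_of_success k w :
  (forall x, differentiable f x) ->
  convex_function (setT : set (convex_lmodType 'rV[R]_n)) f ->
  success k w -> exists i, dot (D k i w) (g (X k w)) < 0.
Proof.
move=> df cf [i]; rewrite /sufficient_decrease => dec; exists i.
have [rho0 _ _] := hrho; have A0 := A_gt0 k w.
have := convex_ge_tangent df (X k w) (X k w + A k w *: D k i w) cf.
rewrite [_ + _ - _]addrC addKr dotZr dotC => h; have := rho0 _ A0 => r0.
rewrite -(pmulr_rlt0 _ A0); lra.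
Qed.

Lemma displacement k w : enorm (X k.+1 w - X k w) <= A k w.
Proof.
have [s|s] := pselect (success k w).
  have /(pds_success hpds)[[i _ XE] _] := s.
  have -> : X k.+1 w - X k w = A k w *: D k i w.
    by rewrite XE [_ + _ - _]addrC addKr.
  by rewrite enormZ (pds_unit hpds k i w) mulr1 (gtr0_norm (A_gt0 k w)).
by have [-> _] := pds_failure hpds s; rewrite subrr enorm0 (ltW (A_gt0 k w)).
Qed.

Lemma displacement_sum J j w :
  enorm (X (J + j)%N w - X J w) <= \sum_(i < j) A (J + i)%N w.
Proof.
elim: j => [|j IH]; first by rewrite addn0 subrr enorm0 big_ord0.
rewrite big_ord_recr addnS /=.
rewrite (_ : _ - _ = (X (J + j)%N w - X J w) + (X (J + j).+1 w - X (J + j)%N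
  w)).
  by apply: le_trans (enormD _ _) _; apply: lerD => //; exact: displacement.
by rewrite [RHS]addrC addrA subrK.
Qed.

Lemma walk_le_A (Y : nat -> set T) J j w :
  (forall i, (i < j)%N -> Y (J + i)%N w -> success (J + i) w) ->
  A J w * walk Y gamma theta J j w <= A (J + j)%N w.
Proof.
elim: j => [|j IH] Ys; first by rewrite walk0 mulr1 addn0.
rewrite walkSr mulrA addnS; have {}IH := IH (fun i ij => Ys i (ltnW ij)).
have W0 : 0 < A J w * walk Y gamma theta J j w by rewrite mulr_gt0 ?A_gt0
  ?walk_gt0.
have [s|s] := pselect (success (J + j) w).
  rewrite A_success // [leRHS]mulrC; apply: ler_pM => //.
  - exact: ltW.
  - by case: ifP => _; exact: ltW.
  - by case: ifP => // _; exact: ltW (lt_trans theta1 hgamma).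
rewrite A_failure // memNset; last by move=> /(Ys _ (ltnSn j)).
by rewrite mulrC ler_pM2l.
Qed.

Lemma A_le_walk (Y : nat -> set T) J j w :
  (forall i, (i < j)%N -> success (J + i) w -> Y (J + i)%N w) ->
  A (J + j)%N w <= A J w * walk Y gamma theta J j w.
Proof.
elim: j => [|j IH] Ys; first by rewrite walk0 mulr1 addn0.
rewrite walkSr mulrA addnS; have {}IH := IH (fun i ij => Ys i (ltnW ij)).
have [s|s] := pselect (success (J + j) w).
  rewrite (mem_set (Ys _ (ltnSn j) s)) (A_success s).
  by rewrite [leRHS]mulrC (ler_pM2l gamma0).
rewrite (A_failure s) mulrC; apply: ler_pM => //.
- exact: ltW (A_gt0 _ _).
- exact: ltW.
- by case: ifP => // _; exact: ltW (lt_trans theta1 hgamma).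
Qed.

End Paths.

(** * Auxiliary real analysis *)

(** A random variable equal to [a] with probability [q] and to [b] otherwise, and
    of negative mean, has an exponential moment below 1. *)
Lemma exists_contraction {R : realType} (q a b : R) :
  0 <= q <= 1 -> q * a + (1 - q) * b < 0 ->
  exists2 s, 0 < s & q * expR (s * a) + (1 - q) * expR (s * b) < 1.
Proof.
move=> /andP[q0 q1] neg.
have exp_le (x : R) : x <= 2^-1 -> expR x <= 1 + x + 2 * x ^+ 2.
  move=> x12; have pos : 0 < 1 - x by lra.
  have := expR_ge1Dx (- x); rewrite expRN => h.
  have : expR x * (1 - x) <= 1.
    by rewrite -ler_pdivlMl ?expR_gt0 // mulr1; exact: h.
  rewrite -ler_pdivlMr // => /le_trans; apply.
  rewrite ler_pdivrMr //.
  have -> : (1 + x + 2 * x ^+ 2) * (1 - x) = 1 + x ^+ 2 * (1 - 2 * x) by ring.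
  rewrite lerDl mulr_ge0 ?sqr_ge0 //; lra.
have [del delE] : exists del, del = - (q * a + (1 - q) * b) by eexists.
have del0 : 0 < del by rewrite delE oppr_gt0.
have q1' : 0 <= 1 - q by lra.
have [C CE] : exists C, C = 2 * (q * a ^+ 2 + (1 - q) * b ^+ 2) by eexists.
have C0 : 0 <= C.
  by rewrite CE mulr_ge0 // addr_ge0 // mulr_ge0 ?sqr_ge0.
have M0 : 0 < `|a| + `|b| + 1 by rewrite ltr_wpDl // addr_ge0.
have [s [s0 sM sC]] : exists s, [/\ 0 < s, s * (`|a| + `|b| + 1) <= 2^-1 &
    s * (2 * (C + 1)) <= del].
  have C1 : 0 < 2 * (C + 1) by rewrite mulr_gt0 // ltr_wpDl.
  exists (Num.min (2^-1 / (`|a| + `|b| + 1)) (del / (2 * (C + 1)))).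
  by rewrite lt_min !divr_gt0 // -!ler_pdivlMr // !ge_min !lexx orbT.
exists s => //.
have sa : s * a <= 2^-1.
  apply: le_trans sM; rewrite ler_pM2l // -addrA;
    apply: le_trans (ler_norm a) _.
  by rewrite lerDl addr_ge0.
have sb : s * b <= 2^-1.
  apply: le_trans sM; rewrite ler_pM2l // (addrC `|a|) -addrA.
  by apply: le_trans (ler_norm b) _; rewrite lerDl addr_ge0.
apply: le_lt_trans (lerD (ler_wpM2l q0 (exp_le _ sa)) (ler_wpM2l q1' (exp_le _
  sb))) _.
have -> : q * (1 + s * a + 2 * (s * a) ^+ 2) + (1 - q) * (1 + s * b + 2 * (s *
  b) ^+ 2) =
    1 + s * (s * C - del) by rewrite CE delE; ring.
have sC0 : 0 <= s * C by rewrite mulr_ge0 // ltW.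
have neg' : s * C - del < 0.
  by move: sC sC0 s0; rewrite mulrCA mulrDr mulr1; move: (s * C) => z; clear;
    lra.
by rewrite -ltrBDl subrr pmulr_rlt0.
Qed.

Lemma sum_geometric_le {R : realType} (x : R) N : 0 <= x < 1 ->
  \sum_(j < N) x ^+ j <= (1 - x)^-1.
Proof.
move=> /andP[x0 x1]; have pos : 0 < 1 - x by rewrite subr_gt0.
rewrite -[leRHS]mulr1 ler_pdivlMl // -opprB mulNr -subrX1 opprB.
by rewrite gerBl exprn_ge0.
Qed.

Section LimInf.
Context {R : realType}.
Variable u : nat -> R.
Local Open Scope ereal_scope.

Lemma limn_einf_eq0 : (forall k, 0 <= u k)%R ->
  (forall e K, (0 < e)%R -> exists2 k, (K <= k)%N & (u k < e)%R) ->
  limn_einf (fun k => (u k)%:E) = 0.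
Proof.
move=> u0 small; rewrite limn_einf_lim.
rewrite (_ : einfs _ = cst 0); first exact: lim_cst.
apply/funext => K /=; apply/eqP; rewrite eq_le; apply/andP; split; last first.
  by apply: le_ereal_inf_tmp => _ [k _ <-]; rewrite lee_fin.
apply/lee_addgt0Pr => e e0; rewrite add0e; have [k Kk ke] := small e K e0.
by apply: ereal_inf_le; exists (u k)%:E; [exists k | rewrite lee_fin ltW].
Qed.

Lemma limn_einf_neq0 (e : R) K : (0 < e)%R ->
  (forall k, (K <= k)%N -> (e <= u k)%R) ->
  limn_einf (fun k => (u k)%:E) <> 0.
Proof.
move=> e0 ue lim0; suff : (e%:E <= 0)%E by rewrite lee_fin leNgt e0.
rewrite -lim0 limn_einf_lim; apply: lime_ge; first exact: is_cvg_einfs.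
exists K => // k /= Kk; apply: le_ereal_inf_tmp => _ [l /= kl <-].
by rewrite lee_fin ue // (leq_trans Kk).
Qed.

End LimInf.

(** * Recurrence and transience of the step sizes *)

Section Convergence.
Context {d : measure_display} {T : measurableType d} {R : realType}.
Context {n m : nat}.
Variables (P : probability T R) (f : 'rV[R]_n -> R) (x0 : 'rV[R]_n).
Variables (alpha0 theta gamma : R) (rho : R -> R).
Variables (D : nat -> 'I_m -> T -> 'rV[R]_n) (X : nat -> T -> 'rV[R]_n).
Variables (A : nat -> T -> R) (e : 'rV[R]_n) (i0 : 'I_m).
Hypothesis halpha0 : 0 < alpha0.
Hypothesis htheta : 0 < theta < 1.
Hypothesis hgamma : 1 < gamma.
Hypothesis hrho : forcing_function rho.
Hypothesis hdiff : forall x, differentiable f x.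
Hypothesis hlip : elipschitz (gradient f).
Hypothesis hpds : pds f x0 alpha0 theta gamma rho D X A.
Hypothesis hunif : iid_uniform_polling P D X.
Hypothesis e1 : enorm e = 1.
Local Notation g := (gradient f).
Local Notation G k w := (gradient f (X k w)).

Let mD := pds_random_D hpds.
Let mX := pds_random_X hpds.
Let D1 := pds_unit hpds.
Let X0 := pds_X0 hpds.
Let theta0 : 0 < theta. Proof. by case/andP: htheta. Qed.
Let gamma0 : 0 < gamma. Proof. exact: lt_trans hgamma. Qed.

(** Some polling direction of iteration [k] has its component along the
    steepest descent direction outside [I]; [hit_prob I] is the probability of
    this event, given the past. *)
Definition hit (I : set R) (k : nat) : set T := ~` all_in D X g e I k.

Definition hit_prob (I : set R) : R := 1 - comp_prob P D e i0 I ^+ m.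

Lemma past_hit I k : measurable I -> past D X k.+1 (hit I k).
Proof.
move=> mI; apply: (@measurableC _ (g_sigma_algebraType (past_gen D X k.+1))).
exact: past_all_in.
Qed.

Lemma past_setI k H H' : past D X k H -> past D X k H' -> past D X k (H `&` H').
Proof. exact: (@measurableI _ (g_sigma_algebraType (past_gen D X k))). Qed.

Lemma past_setC k H : past D X k H -> past D X k (~` H).
Proof. exact: (@measurableC _ (g_sigma_algebraType (past_gen D X k))). Qed.

Lemma prob_hit I k H : measurable I -> past D X k H ->
  P (H `&` hit I k) = ((hit_prob I)%:E * P H)%E.
Proof.
move=> mI mH; have mH' := past_measurable mD mX mH.
have mA : measurable (all_in D X g e I k).
  by apply: (past_measurable mD mX); exact: past_all_in.
have PH : P H \is a fin_num by exact: fin_num_measure.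
rewrite -setDE measureD //=; last by rewrite ltey_eq PH.
rewrite (prob_all_in mD D1 mX X0 i0 hlip e1 hunif mI mH).
by rewrite -(fineK PH) -!EFinM -EFinB /hit_prob mulrBl mul1r.
Qed.

Lemma hit_walk_markov I u l t J j H : measurable I -> 0 < u -> 0 < l -> 0 < t ->
  past D X J H ->
  (P (H `&` [set w | (t <= walk (hit I) u l J j w)%R]) <=
   (t^-1 * (hit_prob I * u + (1 - hit_prob I) * l) ^+ j)%:E * P H)%E.
Proof.
move=> mI u0 l0 t0 FH; apply: (walk_markov (F := past D X)) => //.
- by move=> k; exact: past_measurable.
- by move=> k H' /(past_le (leqnSn k)) mH; apply: past_setI => //;
  exact: past_hit.
- move=> k H' /(past_le (leqnSn k)) mH; apply: past_setI => //.
  by apply: past_setC; exact: past_hit.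
- by move=> k; apply: (past_measurable mD mX); exact: past_hit.
- by move=> k H' mH; exact: prob_hit.
Qed.

Lemma measurable_enorm_G k : measurable_fun setT (fun w => enorm (G k w)).
Proof.
apply: measurable_enorm => i _ B mB.
by apply: (past_measurable mD mX); exact: (past_g X0 hlip).
Qed.

Lemma measurable_liminf :
  measurable [set w | limn_einf (fun k => (enorm (G k w))%:E) = 0%E].
Proof.
have mf : measurable_fun setT (fun w => limn_einf (fun k => (enorm (G k
  w))%:E)).
  rewrite /limn_einf; apply: measurableT_comp => //.
  apply: measurable_fun_limn_esup => k; apply: measurableT_comp => //.
  by apply/measurable_EFinP; exact: measurable_enorm_G.
by have := mf measurableT _ (emeasurable_set1 0%E); rewrite setTI.
Qed.

(** If the mean of the logarithm of a step size factor is positive, then almost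
    surely the gradients cannot stay away from [0] once the step sizes are
      small,
    for the step sizes would then have to increase. *)
Lemma liminf_eq0_ae (kappa : R) :
  has_lbound (range f) -> 0 < kappa ->
  let q := hit_prob [set x | x < kappa] in 0 <= q <= 1 ->
  0 < q * ln gamma + (1 - q) * ln theta ->
  P [set w | limn_einf (fun k => (enorm (G k w))%:E) = 0%E] = 1%E.
Proof.
move=> fl kappa0 q q01 drift.
have mI : measurable [set x : R | x < kappa] by rewrite -set_itvNyo.
have [s s0] : exists2 s, 0 < s &
    q * expR (s * - ln gamma) + (1 - q) * expR (s * - ln theta) < 1.
  by apply: exists_contraction => //; rewrite !mulrN; lra.
rewrite !mulrN -!mulNr.
have powE x : 0 < x -> expR (- s * ln x) = x `^ (- s).
  by move=> xpos; rewrite /powR gt_eqF.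
rewrite !powE //; set r := _ + _ => r1.
have r0 : 0 <= r.
  by rewrite addr_ge0 // mulr_ge0 ?powR_ge0 //; case/andP: q01 => *; lra.
(* the paths on which, from iteration K on, the gradients stay away from 0 and
   the step sizes are at most a; there the walk started at K is at most b *)
pose bad (c a : R) K := [set w | forall k, (K <= k)%N -> c <= enorm (G k w) /\
  A k w <= a].
have bad_null c : 0 < c -> exists2 a, 0 < a & forall K, P.-negligible (bad c a
  K).
  move=> c0; have [a a0 succ] :=
    success_of_descent halpha0 htheta hgamma hrho hpds hdiff hlip c0 kappa0.
  exists a => // K; pose b := a / (alpha0 * theta ^+ K).
  have b0 : 0 < b by rewrite divr_gt0 // mulr_gt0 // exprn_gt0.
  pose B j := [set w | b `^ (- s) <=
    walk (hit [set x | x < kappa]) (gamma `^ (- s)) (theta `^ (- s)) K j w].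
  have mB j : measurable (B j).
    apply: measurable_walk_ge => k; apply: (past_measurable mD mX).
    exact: past_hit.
  have PB j : (P (B j) <= ((b `^ (- s))^-1 * r ^+ j)%:E)%E.
    have := @hit_walk_markov [set x | x < kappa] (gamma `^ (- s)) (theta `^ (-
      s))
      (b `^ (- s)) K j setT mI (powR_gt0 _ gamma0) (powR_gt0 _ theta0)
        (powR_gt0 _ b0).
    rewrite setTI probability_setT mule1; apply.
    exact: (@measurableT _ (g_sigma_algebraType (past_gen D X K))).
  exists (\bigcap_j B j); split.
  - exact: bigcap_measurableType.
  - apply/eqP; rewrite eq_le measure_ge0 andbT.
    apply/lee_addgt0Pr => eps eps0; rewrite add0e.
    have : (fun j => (b `^ (- s))^-1 * r ^+ j) @ \oo --> (b `^ (- s))^-1 * 0.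
      by apply: cvgMr; apply: cvg_expr; rewrite ger0_norm.
    rewrite mulr0 => /cvgrPdist_lt/(_ _ eps0)[j _ /(_ j (leqnn j))] /=.
    rewrite sub0r normrN => /ltW/(le_trans (ler_norm _)) h.
    apply: le_trans (_ : P (B j) <= _)%E; last by apply: le_trans (PB j) _;
      rewrite lee_fin.
    by apply: le_measure; rewrite ?inE //;
      [exact: bigcap_measurableType | exact: bigcap_inf].
  - move=> w bw j _; rewrite /B /= walk_powR //.
    set W := walk _ _ _ _ _ _; have W0 : 0 < W by exact: walk_gt0.
    have WA : A K w * W <= A (K + j)%N w.
      apply: (walk_le_A halpha0 htheta hgamma hpds) => i _.
      move=> /existsNP[i' /negP]; rewrite -leNgt.
      have [cG Aa] := bw _ (leq_addr i K).
      have G0 : 0 < enorm (G (K + i)%N w) by exact: lt_le_trans cG.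
      rewrite /dir dot_unit_dir ?oppr_eq0 -?enorm_gt0 // enormN dotNr => kD.
      apply: (succ _ _ i') => //.
      by rewrite lerNr -ler_pdivlMr.
    have Wb : W <= b.
      rewrite ler_pdivlMr ?mulr_gt0 ?exprn_gt0 // mulrC.
      apply: le_trans (_ : A (K + j)%N w <= _);
        last by apply: (bw _ (leq_addr _ _)).2.
      apply: le_trans WA.
      by rewrite ler_pM2r // (A_lower halpha0 htheta hgamma hpds).
    rewrite !powRN lef_pV2 ?posrE ?powR_gt0 //.
    by apply: ge0_ler_powR => //; rewrite ?nnegrE ltW.
have /choice[a aP] l : exists a, 0 < a /\ forall K, P.-negligible (bad
  l.+1%:R^-1 a K).
  by have [a] := bad_null l.+1%:R^-1 (ltac:(by rewrite invr_gt0)); exists a.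
have null : P.-negligible (\bigcup_l \bigcup_K bad l.+1%:R^-1 (a l) K).
  apply: negligible_bigcup => l; apply: negligible_bigcup => K.
  by have [] := aP l.
have mL := measurable_liminf.
suff PC : P (~` [set w | limn_einf (fun k => (enorm (G k w))%:E) = 0%E]) = 0%E.
  by have := probability_setC P (measurableC mL); rewrite setCK PC sube0.
apply/negligibleP; first exact: measurableC.
apply: negligibleS null => w /= nlim.
apply: contrapT => nbad; apply: nlim; apply: limn_einf_eq0.
  by move=> k; exact: enorm_ge0.
move=> eps K eps0; apply: contrapT => noteps; apply: nbad.
pose l := Num.bound (eps^-1); exists l => //.
have [a0 _] := aP l.
have [K' AK'] := A_cvg0 halpha0 htheta hgamma hrho hpds w fl a0.
exists (maxn K K') => // k; rewrite geq_max => /andP[Kk Kk']; split;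
  last exact: AK'.
rewrite leNgt; apply/negP => small; apply: noteps; exists k => //.
apply: lt_trans small _; rewrite invf_plt ?posrE //.
have := archi_boundP (ltW (_ : 0 < eps^-1)); rewrite invr_gt0 => /(_ eps0).
by move=> /lt_trans; apply; rewrite ltr_nat.
Qed.

Section Convex.
Hypothesis hconv : convex_function (setT : set (convex_lmodType 'rV[R]_n)) f.

Lemma success_hit k w :
  success f rho D X A k w -> hit [set x | x <= 0] k w.
Proof.
move=> s; have [i Di] :=
  descent_of_success halpha0 htheta hgamma hrho hpds hdiff hconv s.
have G0 : G k w != 0.
  by apply: contraTneq Di => ->; rewrite dotC dot0l ltxx.
apply/existsNP; exists i; apply/negP; rewrite -ltNge /dir.
by rewrite dot_unit_dir ?oppr_eq0 // enormN dotNr divr_gt0 ?oppr_gt0 //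
  enorm_gt0.
Qed.

Lemma all_fail J : exists H, [/\ past D X J H,
  P H = ((1 - hit_prob [set x | x <= 0]) ^+ J)%:E &
  forall w, H w -> X J w = x0 /\ A J w = alpha0 * theta ^+ J].
Proof.
have mI : measurable [set x : R | x <= 0] by rewrite -set_itvNyc.
elim: J => [|J [H [mH PH XA]]].
  exists setT; split.
  - exact: (@measurableT _ (g_sigma_algebraType (past_gen D X 0))).
  - by rewrite expr0 probability_setT.
  - by move=> w _; rewrite X0 (pds_A0 hpds) expr0 mulr1.
exists (H `&` all_in D X g e [set x | x <= 0] J); split.
- apply: past_setI; first exact: (past_le (leqnSn J)).
  exact: past_all_in.
- rewrite (prob_all_in mD D1 mX X0 i0 hlip e1 hunif mI mH) PH -EFinM.
  by rewrite /hit_prob opprB addrC subrK exprS.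
- move=> w [/XA[XJ AJ] noY].
  have nos : ~ success f rho D X A J w by move=> /success_hit; apply.
  have [-> ->] := pds_failure hpds nos.
  by rewrite XJ AJ exprS mulrCA.
Qed.

(** If the mean of the logarithm of a step size factor is negative, then with
    positive probability the first [J] iterations fail, and thereafter the step
    sizes are dominated by a geometric sequence; [J] is chosen so large that the
    iterates then remain in a neighbourhood of [x0] where the gradient is
      bounded
    away from [0]. *)
Lemma liminf_eq0_not_ae :
  let q := hit_prob [set x | x <= 0] in 0 <= q -> q < 1 ->
  q * ln gamma + (1 - q) * ln theta < 0 -> g x0 != 0 ->
  P [set w | limn_einf (fun k => (enorm (G k w))%:E) = 0%E] <> 1%E.
Proof.
move=> q q0 q1 drift gx0.
have mI : measurable [set x : R | x <= 0] by rewrite -set_itvNyc.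
have [s s0] : exists2 s, 0 < s &
    q * expR (s * ln gamma) + (1 - q) * expR (s * ln theta) < 1.
  by apply: exists_contraction => //; rewrite q0 ltW.
have powE x : 0 < x -> expR (s * ln x) = x `^ s.
  by move=> xpos; rewrite /powR gt_eqF.
rewrite !powE //; set r := _ + _ => r1.
have r0 : 0 < r.
  by rewrite ltr_wpDl // ?mulr_ge0 ?powR_ge0 // mulr_gt0 ?powR_gt0 // subr_gt0.
pose x := Num.sqrt r; have x0' : 0 < x by rewrite sqrtr_gt0.
have xx : x ^+ 2 = r by rewrite sqr_sqrtr // ltW.
have x1 : x < 1 by rewrite -(@ltr_pXn2r _ 2) ?nnegrE ?ltW // xx expr1n.
(* the walk exceeds C x^j at time j with probability at most x^j / C; for this C
   these bounds add up to 1/2 *)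
pose C := 2 / (1 - x); have C0 : 0 < C by rewrite divr_gt0 // subr_gt0.
pose xi := x `^ s^-1; pose C' := C `^ s^-1.
have s'0 : 0 < s^-1 by rewrite invr_gt0.
have xi0 : 0 < xi by exact: powR_gt0.
have C'0 : 0 < C' by exact: powR_gt0.
have xi1 : xi < 1.
  have : xi < 1 `^ s^-1 by apply: gt0_ltr_powR => //; rewrite ?nnegrE ?ltW.
  by rewrite powR1.
have [L L0 gL] := elipschitz_gt0 hlip.
pose eta := enorm (g x0) / (2 * L).
have gx0' : 0 < enorm (g x0) by rewrite enorm_gt0.
have eta0 : 0 < eta by rewrite divr_gt0 // mulr_gt0.
have [J JP] : exists J, alpha0 * C' / (1 - xi) * theta ^+ J <= eta.
  have : (fun j => alpha0 * C' / (1 - xi) * theta ^+ j) @ \oo -->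
      alpha0 * C' / (1 - xi) * 0.
    apply: cvgMr; apply: cvg_expr; rewrite gtr0_norm //.
    by case/andP: htheta.
  rewrite mulr0 => /cvgrPdist_lt/(_ _ eta0)[J _ /(_ J (leqnn J))] /=.
  by rewrite sub0r normrN => /ltW/(le_trans (ler_norm _)); exists J.
have [H [pH PH XA]] := all_fail J.
have mH : measurable H by exact: past_measurable pH.
pose B j := [set w | C * x ^+ j <=
  walk (hit [set x | x <= 0]) (gamma `^ s) (theta `^ s) J j w].
have mB j : measurable (B j).
  apply: measurable_walk_ge => k; apply: (past_measurable mD mX).
  exact: past_hit.
have PB j : (P (H `&` B j) <= (C^-1 * (1 - q) ^+ J * x ^+ j)%:E)%E.
  apply: le_trans (hit_walk_markov j mI (powR_gt0 _ gamma0) (powR_gt0 _ theta0)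
    _ pH) _.
    by rewrite mulr_gt0 // exprn_gt0.
  rewrite PH -EFinM lee_fin le_eqVlt; apply/orP; left; apply/eqP.
  rewrite -/q -/r -xx -exprM mulnC exprM invfM.
  have xj0 : x ^+ j != 0 by rewrite gt_eqF // exprn_gt0.
  by rewrite expr2; field; rewrite xj0 gt_eqF.
have mUB : measurable (\bigcup_j B j) by exact: bigcupT_measurable.
have PHU : (P (H `&` \bigcup_j B j) <= (2^-1 * (1 - q) ^+ J)%:E)%E.
  rewrite setI_bigcupr.
  have mHB j : measurable (H `&` B j) by exact: measurableI.
  have := measure_sigma_subadditive P mHB (bigcupT_measurable _ mHB)
    (@subset_refl _ _).
  move=> /le_trans; apply.
  apply: lime_le; first by apply: is_cvg_nneseries.
  apply: nearW => N; apply: le_trans (lee_sum _ (fun j _ => PB j)) _.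
  rewrite sumEFin lee_fin -mulr_sumr big_mkord.
  have -> : 2^-1 * (1 - q) ^+ J = C^-1 * (1 - q) ^+ J * (1 - x)^-1.
    by rewrite /C invf_div; field; rewrite subr_eq0 eq_sym lt_eqF.
  rewrite ler_wpM2l //; last by apply: sum_geometric_le; rewrite ltW.
  by rewrite mulr_ge0 ?invr_ge0 ?exprn_ge0 // ?ltW // subr_gt0.
pose Gam := H `\` \bigcup_j B j.
have mGam : measurable Gam by exact: measurableD.
have PGam : (0 < P Gam)%E.
  rewrite measureD //=; last by rewrite PH ltry.
  rewrite PH sube_gt0; apply: le_lt_trans PHU _; rewrite lte_fin.
  by rewrite gtr_pMl ?exprn_gt0 ?subr_gt0 // invf_lt1 // ltr1n.
have stay w : Gam w -> forall k, (J <= k)%N -> enorm (g x0) / 2 <= enorm (G k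
  w).
  move=> [Hw nB] k Jk; have [XJ AJ] := XA _ Hw.
  have walk_le j : walk (hit [set x | x <= 0]) gamma theta J j w <= C' * xi ^+
    j.
    have nBj : ~ B j w by move=> Bj; apply: nB; exists j.
    move/negP: nBj; rewrite -ltNge walk_powR // => /ltW h.
    set W := walk _ _ _ _ _ _ in h *; have W0 : 0 < W by exact: walk_gt0.
    have WE : W = (W `^ s) `^ s^-1 by rewrite -powRrM mulfV ?powRr1 ?gt_eqF //
      ltW.
    rewrite WE; apply: le_trans (ge0_ler_powR (ltW s'0) _ _ h) _;
      rewrite ?nnegrE ?powR_ge0 //.
      by rewrite mulr_ge0 ?exprn_ge0 ?ltW.
    rewrite powRM; [|exact: ltW|by rewrite exprn_ge0 // ltW].
    rewrite ler_pM2l // -(powR_mulrn j (ltW x0')).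
    by rewrite -powRrM (mulrC j%:R) powRrM powR_mulrn ?powR_ge0.
  have A_le j : A (J + j)%N w <= alpha0 * theta ^+ J * C' * xi ^+ j.
    apply: le_trans (A_le_walk halpha0 htheta hgamma hpds
      (Y := hit [set x | x <= 0]) _) _.
      by move=> i _; exact: success_hit.
    by rewrite AJ -[leRHS]mulrA ler_pM2l // mulr_gt0 // exprn_gt0.
  have Xk : enorm (X k w - x0) <= eta.
    rewrite -(subnKC Jk) -XJ.
    apply: le_trans (displacement_sum halpha0 htheta hgamma hpds _ _ _) _.
    apply: (@le_trans _ _ (\sum_(i < k - J) alpha0 * theta ^+ J * C' * xi ^+
      i)).
      by apply: ler_sum => i _; exact: A_le.
    rewrite -mulr_sumr; apply: le_trans JP.
    have -> : alpha0 * C' / (1 - xi) * theta ^+ J =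
        alpha0 * theta ^+ J * C' * (1 - xi)^-1 by ring.
    rewrite ler_pM2l ?mulr_gt0 ?exprn_gt0 //.
    by apply: sum_geometric_le; rewrite ltW.
  have gX : enorm (g x0 - G k w) <= enorm (g x0) / 2.
    apply: le_trans (gL _ _) _; rewrite -(enormN (x0 - X k w)) opprB.
    apply: le_trans (_ : L * eta <= _); first by rewrite ler_pM2l.
    by rewrite /eta le_eqVlt; apply/orP; left; apply/eqP; field; rewrite gt_eqF.
  have := enorm_sub_le (g x0) (G k w); move: gX.
  by move: (enorm (g x0)) (enorm (G k w)) (enorm (_ - _)) => a b c *; lra.
set Lim := [set w | _]; move=> PLim.
have : (P Gam <= P (~` Lim))%E.
  apply: le_measure; rewrite ?inE //; first by apply: measurableC;
    exact: measurable_liminf.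
  move=> w Gw; apply: (limn_einf_neq0 (e := enorm (g x0) / 2) (K := J));
    last exact: stay.
  by rewrite divr_gt0.
rewrite probability_setC; last exact: measurable_liminf.
by rewrite PLim subee // leNgt PGam.
Qed.

End Convex.

(** * Probabilistic descent *)

Lemma cm_ge_hit cm0 (kappa : R) k w : -1 < kappa -> G k w != 0 ->
  kappa <= cm cm0 (fun i => D k i w) (- G k w) <->
  hit [set x | x < kappa] k w.
Proof.
move=> k1 G0; have NG0 : - G k w != 0 by rewrite oppr_eq0.
have E i : dot (D k i w) (- G k w) / (enorm (D k i w) * enorm (- G k w)) =
    dot (D k i w) (dir X g e k w).
  by rewrite /dir dot_unit_dir // D1 mul1r.
rewrite /cm (negbTE NG0) leNgt; under eq_bigr do rewrite E.
split=> [/negP|] h; last by apply/negP => /bigmax_ltP[_ h']; apply: h => i;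
  exact: h'.
by move=> h'; apply: h; apply/bigmax_ltP; split => // i _; exact: h'.
Qed.

(** The conditional probability of descent has a version equal to
    [hit_prob [set x | x < kappa]] where the gradient does not vanish and to [1]
    where it does; there the cosine measure is [cm0], so that the value [1] is
    right if [kappa <= cm0] and immaterial if the gradient vanishes with
    probability zero. *)
Lemma probabilistic_descent_of_hit cm0 (kappa p : R) :
  -1 < kappa -> p <= 1 -> p <= hit_prob [set x | x < kappa] ->
  0 <= hit_prob [set x | x < kappa] ->
  (kappa <= cm0 \/ forall k, P [set w | G k w = 0] = 0%E) ->
  probabilistic_descent P cm0 f D X p kappa.
Proof.
move=> k1 p1 pq q0 cmk k; set q := hit_prob _ in pq q0.
set E := [set w | _].
have mI : measurable [set x : R | x < kappa] by rewrite -set_itvNyo.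
pose Z := [set w | G k w = 0].
have pZ : past D X k Z by exact: past_g_eq0.
have pN : past D X k (~` Z) by exact: past_setC.
have mZ : measurable Z by exact: past_measurable pZ.
have mN : measurable (~` Z) by exact: measurableC.
pose h (w : T) : R :=
  if w \in Z then 1 else q.
have ph : measurable_fun (T := g_sigma_algebraType (past_gen D X k)) setT h.
  apply: measurable_fun_ifT => //.
  apply: (measurable_fun_bool true); rewrite setTI.
  rewrite (_ : _ @^-1` _ = Z) //.
  by apply/seteqP; split => w /= Zw; [exact: set_mem | exact: mem_set].
have ph' Y : measurable Y -> past D X k (h @^-1` Y).
  by move=> mY; have := ph measurableT Y mY; rewrite setTI.
have mh : measurable_fun setT h.
  by move=> _ Y mY; rewrite setTI; apply: (past_measurable mD mX); exact: ph'.
have EZ : E `&` Z = Z /\ kappa <= cm0 \/ E `&` Z = set0.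
  have [kc|kc] := leP kappa cm0; [left; split => //|right];
    apply/seteqP; split => w //=; rewrite /E /Z /= /cm.
  - by case.
  - by move=> Gw; split => //; rewrite Gw oppr0 eqxx.
  - by move=> [+ Gw]; rewrite Gw oppr0 eqxx leNgt kc.
have mEZ : measurable (E `&` Z) by case: EZ => [[->]|->].
have EN : E `&` ~` Z = hit [set x | x < kappa] k `&` ~` Z.
  apply/seteqP; split => w /= [Ew /[dup] Zw /eqP Gw]; split => //.
    exact: (cm_ge_hit cm0 k1 Gw).1 Ew.
  exact: (cm_ge_hit cm0 k1 Gw).2 Ew.
exists h.
  split => //.
  - apply: measurable_bounded_integrable => //.
      exact: le_lt_trans (probability_le1 P measurableT) (ltry _).
    exists (1 + q); split; first exact: num_real.
    move=> x xq w _; rewrite /h; apply: le_trans (ltW xq).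
    by case: ifP => _; rewrite ger0_norm ?lerDl ?lerDr.
  - move=> B pB; have mB : measurable B by exact: past_measurable pB.
    rewrite -(setIT B) -(setUv Z) setIUr ge0_integral_setU //; first last.
    + by apply/disj_setPS => w /= [[_ ?] [_]].
    + by move=> w _; rewrite lee_fin /h; case: ifP.
    + by apply: measurable_funTS; apply/measurable_EFinP.
    + exact: measurableI.
    + exact: measurableI.
    rewrite (eq_integral (fun=> 1%:E)); last first.
      by move=> w; rewrite inE => -[_ Zw]; rewrite /h mem_set.
    rewrite [X in (_ + X)%E](eq_integral (fun=> q%:E)); last first.
      by move=> w; rewrite inE => -[_ Zw]; rewrite /h memNset.
    rewrite !integral_cst ?mul1e; [|exact: measurableI|exact: measurableI].
    rewrite -(prob_hit mI (past_setI pB pN)).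
    rewrite -setIUr setUv setIT.
    have -> : E `&` B = (B `&` (E `&` Z)) `|` (B `&` ~` Z `&` hit [set x | x <
      kappa] k).
      rewrite -setIA (setIC (~` Z)) -EN -setIUr -setIUr setUv setIT setIC //.
    have m1 : measurable (B `&` (E `&` Z)) by exact: measurableI.
    have m2 : measurable (B `&` ~` Z `&` hit [set x | x < kappa] k).
      apply: measurableI; first exact: measurableI.
      by apply: (past_measurable mD mX); exact: past_hit.
    rewrite measureU //; last first.
      by apply/seteqP; split => w // [[_ [_ Zw]] [[_ nZ] _]]; case: nZ.
    congr (_ + _)%E; case: EZ => [[->] //|EZ0].
    case: cmk => [kc|/(_ k) PZ].
      suff -> : Z = set0 by rewrite !setI0 !measure0.
      rewrite -EZ0; apply/seteqP; split => [w Zw|w []//]; split => //.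
      by rewrite /E /= /cm Zw oppr0 eqxx.
    rewrite EZ0 setI0 measure0; apply/eqP; rewrite eq_le measure_ge0 andbT -PZ.
    by apply: le_measure; rewrite ?inE //; exact: measurableI.
by apply: aeW => w; rewrite /h; case: ifP.
Qed.

(** The past of iteration [0] is trivial, and its gradient is that at [x0]. *)
Lemma hit_prob_of_probabilistic_descent cm0 (kappa p : R) :
  -1 < kappa -> 0 <= p -> g x0 != 0 -> probabilistic_descent P cm0 f D X p
    kappa ->
  p <= hit_prob [set x | x < kappa].
Proof.
move=> k1 p0 gx0 /(_ 0%N)[h [ph ih intE] ph'].
have mI : measurable [set x : R | x < kappa] by rewrite -set_itvNyo.
have pT : past D X 0 setT by exact: (@measurableT _ (g_sigma_algebraType
  (past_gen D X 0))).
have := intE _ pT; rewrite setIT.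
rewrite (_ : [set w | _] = setT `&` hit [set x | x < kappa] 0); last first.
  rewrite setTI; apply/seteqP; split => w /=; apply cm_ge_hit => //;
    by rewrite X0.
rewrite prob_hit // probability_setT mule1 => hq.
have mh : measurable_fun setT h.
  by move=> _ Y mY; rewrite setTI; apply: (past_measurable mD mX); exact: ph.
rewrite -lee_fin -hq (@ae_eq_integral _ _ _ P setT (fun w => (Num.max (h w)
  p)%:E)) //.
- rewrite -[leLHS]mule1 -(probability_setT P) -integral_cst //.
  apply: ge0_le_integral => //.
  + by apply/measurable_EFinP; exact: measurable_maxr.
  + by move=> w _; rewrite lee_fin le_max lexx orbT.
- by apply/measurable_EFinP.
- by apply/measurable_EFinP; exact: measurable_maxr.
- by move: ph'; apply: filterS => w pw _; rewrite max_l.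
Qed.

End Convergence.

(** * The threshold on the number of polling directions *)

Section Threshold.
Context {R : realType}.
Variables (theta gamma : R) (m : nat).
Hypothesis htheta : 0 < theta < 1.
Hypothesis hgamma : 1 < gamma.
Let p0 := ln theta / ln (gamma^-1 * theta).

Let lt0 : ln theta < 0. Proof. by rewrite ln_lt0. Qed.
Let lg0 : 0 < ln gamma. Proof. exact: ln_gt0. Qed.

Let p0E : p0 = ln theta / (ln theta - ln gamma).
Proof.
case/andP: htheta => t0 _; have g0 : 0 < gamma by exact: lt_trans hgamma.
by rewrite /p0 lnM ?posrE ?invr_gt0 // lnV ?posrE // addrC.
Qed.

Let onem_p0E : 1 - p0 = (1 - ln theta / ln gamma)^-1.
Proof.
have d0 : ln theta - ln gamma < 0 by rewrite subr_lt0 (lt_trans lt0).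
have y0 : 0 < 1 - ln theta / ln gamma.
  by rewrite subr_gt0 (lt_trans _ ltr01) // pmulr_llt0 // invr_gt0.
rewrite p0E; field; rewrite (gt_eqF lg0) (lt_eqF d0) /= andbT.
by rewrite subr_eq0 eq_sym -subr_eq0 (lt_eqF d0).
Qed.

Lemma p0_bounds : 0 < p0 < 1.
Proof.
have d0 : ln theta - ln gamma < 0 by rewrite subr_lt0 (lt_trans lt0).
rewrite p0E nmulr_lgt0 // ?invr_lt0 //.
by rewrite lt0 ltr_ndivrMr // mul1r gtrBl.
Qed.

(** The mean of the logarithm of a step size factor has the sign of [q - p0]. *)
Lemma drift_gt0 (q : R) : (0 < q * ln gamma + (1 - q) * ln theta) = (p0 < q).
Proof.
have d0 : ln theta - ln gamma < 0 by rewrite subr_lt0 (lt_trans lt0).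
rewrite p0E ltr_ndivrMr // -[RHS]subr_gt0; congr (0 < _); ring.
Qed.

Lemma drift_lt0 (q : R) : (q * ln gamma + (1 - q) * ln theta < 0) = (q < p0).
Proof.
have d0 : ln theta - ln gamma < 0 by rewrite subr_lt0 (lt_trans lt0).
rewrite p0E ltr_ndivlMr // -[RHS]subr_lt0; congr (_ < 0); ring.
Qed.

Let y1 : 1 < 1 - ln theta / ln gamma.
Proof. by rewrite ltrDl oppr_gt0 pmulr_llt0 // invr_gt0. Qed.

Lemma threshold_lt :
  (log2 (1 - ln theta / ln gamma) < m%:R) = ((2^-1) ^+ m < 1 - p0).
Proof.
have y0 := lt_trans ltr01 y1.
rewrite onem_p0E exprVn ltf_pV2 ?posrE ?exprn_gt0 //.
have l2 : 0 < ln (2 : R) by rewrite ln_gt0 // ltr1n.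
by rewrite /log2 ltr_pdivrMr // mulr_natl -lnXn // ltr_ln ?posrE ?exprn_gt0.
Qed.

Lemma threshold_eq :
  (2^-1) ^+ m = 1 - p0 -> log2 (1 - ln theta / ln gamma) = m%:R.
Proof.
rewrite onem_p0E exprVn => /invr_inj <-.
have l2 : 0 < ln (2 : R) by rewrite ln_gt0 // ltr1n.
by rewrite /log2 lnXn // -(mulr_natl (ln 2)) mulfK // gt_eqF.
Qed.

End Threshold.

Section CompProb.
Context {d : measure_display} {T : measurableType d} {R : realType}.
Context {n m : nat}.
Variables (P : probability T R) (D : nat -> 'I_m -> T -> 'rV[R]_n).
Variables (e : 'rV[R]_n) (i0 : 'I_m).
Hypothesis mD : forall k i, random_vector (D k i).
Local Notation comp := (comp_prob P D e i0).

Lemma comp_prob_ge0 I : 0 <= comp I.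
Proof. exact: fine_ge0. Qed.

Lemma comp_prob_le1 I : measurable I -> comp I <= 1.
Proof.
move=> mI; rewrite -lee_fin fineK; first by apply: probability_le1;
  exact: measurable_dot_event.
by apply: fin_num_measure; exact: measurable_dot_event.
Qed.

Lemma comp_prob_le I I' : measurable I -> measurable I' -> I `<=` I' ->
  comp I <= comp I'.
Proof.
move=> mI mI' II'; apply: fine_le.
- by apply: fin_num_measure; exact: measurable_dot_event.
- by apply: fin_num_measure; exact: measurable_dot_event.
by apply: le_measure; rewrite ?inE; try exact: measurable_dot_event; move=> w;
  exact: II'.
Qed.

(** By continuity from above, small positive bounds on the component are almost
    as good as the bound 0. *)
Lemma comp_prob_lt_cvg (t : R) : comp [set x | x <= 0] < t ->
  exists2 kappa, 0 < kappa <= 1 & comp [set x | x < kappa] < t.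
Proof.
move=> ct; pose E l := [set w | dot (D 0%N i0 w) e < l.+1%:R^-1].
have mI (c : R) : measurable [set x : R | x < c] by rewrite -set_itvNyo.
have mE l : measurable (E l) by exact: (measurable_dot_event e (mD 0%N i0) (mI
  _)).
have capE : \bigcap_l E l = [set w | dot (D 0%N i0 w) e <= 0].
  apply/seteqP; split => w /= h.
    rewrite leNgt; apply/negP => h0.
    have := h (Num.bound (dot (D 0%N i0 w) e)^-1) I;
      rewrite /E /= ltNge => /negP; apply.
    rewrite invf_ple ?posrE //; apply: ltW.
    apply: lt_trans (archi_boundP _) _; first by rewrite invr_ge0 ltW.
    by rewrite ltr_nat.
  by move=> l _; apply: le_lt_trans h _; rewrite invr_gt0.
have mcap : measurable (\bigcap_l E l) by exact: bigcap_measurableType.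
have cvgE : fine (P (E l)) @[l --> \oo] --> comp [set x | x <= 0].
  apply: fine_cvg; rewrite /comp_prob fineK;
    last by rewrite fin_num_measure // -capE.
  rewrite -capE; apply: nonincreasing_cvg_mu => //.
    by apply: le_lt_trans (probability_le1 P (mE _)) _; exact: ltry.
  apply/nonincreasing_seqP => l; apply/subsetPset => w; rewrite /E /= => h.
  by apply: lt_trans h _; rewrite ltf_pV2 ?posrE // ltr_nat.
have : \forall l \near \oo, fine (P (E l)) < t by apply: (cvgr_lt _ cvgE).
case=> l _ /(_ l (leqnn l)) /= lt_t; exists l.+1%:R^-1 => //.
by rewrite invr_gt0 ltr0n /= invf_le1 ?ler1n.
Qed.

End CompProb.

(* For cm0 > 0 the conclusion is the equivalence of a, b and c. If cm0 <= 0 and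
   G k vanishes with positive probability for some k, then c fails whatever m
   is, because cm equals cm0 < kappa on that event while p0 > 0. *)
Theorem theorem3p4 (R : realType) (n m : nat) (f : 'rV[R]_n -> R)
    (x0 : 'rV[R]_n) (alpha0 theta gamma : R) (rho : R -> R) (cm0 : R)
    (d : measure_display) (T : measurableType d) (P : probability T R)
    (D : nat -> 'I_m -> T -> 'rV[R]_n) (X : nat -> T -> 'rV[R]_n)
    (A : nat -> T -> R)
    (hn : (0 < n)%N) (hm : (0 < m)%N)
    (halpha0 : 0 < alpha0) (htheta : 0 < theta < 1) (hgamma : 1 < gamma)
    (hrho : forcing_function rho) (hcm0 : -1 <= cm0 <= 1)
    (hdiff : forall x, differentiable f x)
    (hconv : convex_function (setT : set (convex_lmodType 'rV[R]_n)) f)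
    (hbnd : has_lbound (range f))
    (hlip : elipschitz (gradient f))
    (hpds : pds f x0 alpha0 theta gamma rho D X A)
    (hunif : iid_uniform_polling P D X)
    (hx0 : ~ minimizers f x0)
    (hnint : log2 (1 - ln theta / ln gamma) \isn't a Num.int) :
  let p0 := ln theta / ln (gamma^-1 * theta) in
  let G k w := gradient f (X k w) in
  let a := P [set w | limn_einf (fun k => (enorm (G k w))%:E) = 0%E] = 1%E in
  let b := m%:R > log2 (1 - ln theta / ln gamma) in
  let c := exists2 kappa : R, 0 < kappa <= 1 &
             probabilistic_descent P cm0 f D X p0 kappa in
  [/\ a <-> b,
      c -> b &
      (0 < cm0 \/ forall k, {ae P, forall w, G k w != 0}) -> b -> c].
Proof.
move=> p0 G a b c.
have [e e1] : exists e : 'rV[R]_n, enorm e = 1.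
  exists (delta_mx 0 (Ordinal hn));
    rewrite /enorm /dot (bigD1 (Ordinal hn)) //=.
  rewrite big1 => [|i /negbTE ni]; last by rewrite !mxE ni /= mulr0.
  by rewrite !mxE !eqxx mulr1 addr0 sqrtr1.
have e0 : e != 0 by rewrite -enorm_eq0 e1 oner_eq0.
pose i0 := Ordinal hm.
have mD := pds_random_D hpds; have D1 := pds_unit hpds.
have gx0 : gradient f x0 != 0.
  by apply/eqP => /(gradient_eq0_minimizer hdiff hconv).
have mlt (k : R) : measurable [set x : R | x < k] by rewrite -set_itvNyo.
have mle : measurable [set x : R | x <= 0] by rewrite -set_itvNyc.
pose comp := comp_prob P D e i0; pose hitp := hit_prob P D e i0.
have compE : comp [set x | x <= 0] = 2^-1.
  have [ud _ _] := hunif 0%N.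
  by rewrite /comp /comp_prob (uniform_dot_le0 hn (mD 0%N i0) (D1 0%N i0) (ud
    i0) e0).
have hitE : hitp [set x | x <= 0] = 1 - 2^-1 ^+ m by rewrite /hitp /hit_prob
  -/comp compE.
have /andP[p00 p01] := p0_bounds htheta hgamma; rewrite -/p0 in p00 p01.
have bE : b = ((2^-1) ^+ m < 1 - p0) by exact: threshold_lt.
have hit01 I : measurable I -> 0 <= hitp I <= 1.
  move=> mI; rewrite subr_ge0 gerBl exprn_ge0 ?comp_prob_ge0 // andbT.
  by rewrite exprn_ile1 ?comp_prob_ge0 // comp_prob_le1.
have nbE : ~ b -> hitp [set x | x <= 0] < p0.
  move=> /negP; rewrite bE -leNgt le_eqVlt => /orP[/eqP h|];
    last by rewrite hitE; lra.
  have /esym logm := threshold_eq htheta hgamma (esym h).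
  by case/negP: hnint; rewrite -logm; exact: intr_nat.
(* if b holds, cosines above k are met with probability larger than p0 when k is
   small; t is the m-th root of 1 - p0 *)
have bK : b -> exists2 k0, 0 < k0 <= 1 & forall k, k <= k0 -> p0 < hitp [set x
  | x < k].
  rewrite bE => bm; pose t := (1 - p0) `^ m%:R^-1.
  have q0 : 0 < 1 - p0 by rewrite subr_gt0.
  have mR0 : m%:R != 0 :> R by rewrite pnatr_eq0 -lt0n.
  have tm : t ^+ m = 1 - p0.
    by rewrite -powR_mulrn ?powR_ge0 // -powRrM mulVf // powRr1 // ltW.
  have t0 : 0 <= t by exact: powR_ge0.
  have ct : comp [set x | x <= 0] < t.
    by rewrite compE -(@ltr_pXn2r _ m) ?nnegrE // tm.
  have [k0 k01 ck] := comp_prob_lt_cvg mD ct; exists k0 => // k kk0.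
  rewrite /hitp /hit_prob ltrBrDr addrC -ltrBrDr -tm ltr_pXn2r ?nnegrE
    ?comp_prob_ge0 //.
  apply: le_lt_trans ck; apply: comp_prob_le => // x /= /lt_le_trans; exact.
split.
- split=> [ha'|hb].
    apply: contrapT => /nbE hq.
    have /andP[h0 _] := hit01 _ mle.
    have := liminf_eq0_not_ae halpha0 htheta hgamma hrho hdiff hlip hpds hunif
      e1 (i0 := i0) hconv.
    by apply; rewrite ?drift_lt0 //; exact: lt_trans p01.
  have [k0 /andP[k00 _] pq] := bK hb.
  apply: (liminf_eq0_ae halpha0 htheta hgamma hrho hdiff hlip hpds hunif e1 (i0
    := i0) hbnd k00).
    exact: hit01.
  by rewrite drift_gt0 //; exact: pq.
- case=> k /andP[k0 _] desc; apply: contrapT => /nbE; apply/negP;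
  rewrite -leNgt.
  have k1 : -1 < k by apply: lt_trans k0; rewrite ltrN10.
  have := hit_prob_of_probabilistic_descent i0 hlip hpds hunif e1 k1 (ltW p00)
    gx0 desc.
  move=> /le_trans; apply; rewrite lerD2l lerN2 lerXn2r ?nnegrE ?comp_prob_ge0
    //.
  by apply: comp_prob_le => // x /= /le_lt_trans; apply.
- move=> cmG hb; have [k0 /andP[k00 k01] pq] := bK hb.
  pose k := if 0 < cm0 then Num.min k0 cm0 else k0.
  have k_le : k <= k0 by rewrite /k; case: ifP => // _; rewrite ge_min lexx.
  have k_gt : 0 < k by rewrite /k; case: ifP => // c0; rewrite lt_min k00.
  exists k; first by rewrite k_gt (le_trans k_le).
  have /andP[h0 _] := hit01 _ (mlt k).
  apply: (probabilistic_descent_of_hit hlip hpds hunif e1 (i0 := i0)) => //.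
  + by apply: lt_trans k_gt; rewrite ltrN10.
  + exact: ltW.
  + by apply: ltW; exact: pq.
  + have [c0|c0] := boolP (0 < cm0).
      by left; rewrite /k c0 ge_min lexx orbT.
    case: cmG => [|nG]; first by rewrite (negbTE c0).
    right=> j; apply/negligibleP.
      apply: (past_measurable mD (pds_random_X hpds)).
      exact: (past_g_eq0 (pds_X0 hpds) hlip).
    by apply: negligibleS (nG j) => w /= Gw; rewrite /G Gw eqxx.
Qed.
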